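(* Let $P\in\mathcal S(\pi)$ be compact on $L^2(\pi)$, let $G$ be a locally compact topological group with Haar measure $\mu$ acting on $\mathcal X$, and assume $\pi$ is $G$-invariant. Then for any probability measure $\nu$ on $G\times G$, $$\gamma((P_{la})_{ra})\ge\gamma(P_{da}(G,\nu)).$$
   Context: $\mathcal X$ is a Polish space with its $\sigma$-algebra $\mathcal F$; $\pi$ is a probability measure on $\mathcal X$; a Markov kernel $P$ acts by $P[f](x)=\int f(y)P(x,dy)$. $\mathcal S(\pi)$ is the set of Markov kernels with $\pi P=\pi$, viewed as bounded operators on the real Hilbert space $L^2(\pi)$ with adjoint $P^*$. $L^2_0(\pi)=\{f\in L^2(\pi):\int f\,d\pi=0\}$. $G$ acts measurably on $\mathcal X$; $\mu$ is normalized to be a probability measure. $U_g[f](x)=f(gx)$. $\pi$ is $G$-invariant if $\pi(gA)=\pi(A)$ for all $g\in G,A\in\mathcal F$. Standing assumption: $\pi$ has a density with respect to a reference measure $\mathfrak m$ on $\mathcal X$, and $\mathfrak m$ is invariant under every $g\in G$. $P_{da}(G,\nu)=\mathbb E_{(g,h)\sim\nu}(U_gPU_h)$ and $(P_{la})_{ra}=\mathbb E_{(g,h)\sim\mu\otimes\mu}(U_gPU_h)$. The multiplicative spectral gap of a kernel $T$ is $\gamma(T)=\inf\{\langle f,(I-\sqrt{TT^*})[f]\rangle_\pi:f\in L_0^2(\pi),\|f\|_\pi=1\}$. *)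

(* Defs.v *)
From HB Require Import structures.
From mathcomp Require Import all_boot all_order all_algebra.
From mathcomp Require Import all_classical all_reals all_analysis.

Set Implicit Arguments.
Unset Strict Implicit.
Unset Printing Implicit Defensive.

Import Order.TTheory GRing.Theory Num.Theory.
Import numFieldNormedType.Exports.

Local Open Scope classical_set_scope.
Local Open Scope ring_scope.

(* Pointedness is only there because measurableType requires it; it costs
   nothing, as a space carrying a probability measure is nonempty. *)
Notation borelType T := (g_sigma_algebraType (@open T)).

Definition polish_space (R : realType) (T : topologicalType) : Prop :=
  (exists2 D : set T, countable D & dense D) /\
  exists dist : T -> T -> R,
    [/\ (forall x y, 0 <= dist x y) /\ (forall x y, dist x y = 0 <-> x = y),
        (forall x y, dist x y = dist y x) /\
        (forall x y z, dist x z <= dist x y + dist y z),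
        (forall x (A : set T), nbhs x A <->
           exists2 e : R, 0 < e & [set y | dist x y < e] `<=` A) &
        (forall u : nat -> T,
           (forall e : R, 0 < e -> exists N : nat,
              forall m n, (N <= m)%N -> (N <= n)%N -> dist (u m) (u n) < e) ->
           exists l : T, u @ \oo --> l)].

HB.mixin Record isTopologicalGroup G & PointedTopological G & Group G := {
  mulg_continuous : continuous (fun xy : G * G => (xy.1 * xy.2)%g) ;
  invg_continuous : continuous (fun x : G => (x^-1)%g) }.

#[short(type="topologicalGroupType")]
HB.structure Definition TopologicalGroup :=
  {G of PointedTopological G & Group G & isTopologicalGroup G}.

(* Left Haar measures. For Hausdorff G every compact set is Borel, so the
   measurability conditions on K are then automatic. *)
Definition haar_measure (R : realType) (G : topologicalGroupType)
    (mu : {measure set (borelType G) -> \bar R}) : Prop :=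
  [/\ mu setT != 0%E,
      (forall (g : G) (A : set (borelType G)), measurable A ->
         mu [set (g * h)%g | h in (A : set G)] = mu A),
      (forall K : set G, compact K -> measurable (K : set (borelType G)) ->
         (mu K < +oo)%E),
      (forall A : set (borelType G), measurable A ->
         mu A = ereal_inf [set mu U | U in [set U : set G |
                             open U /\ (A : set G) `<=` U]]) &
      (forall U : set G, open U ->
         mu U = ereal_sup [set mu K | K in [set K : set G |
           [/\ compact K, measurable (K : set (borelType G)) & K `<=` U]]])].

(* On G * X the sigma-algebra is the product of the two Borel sigma-algebras. *)
Definition measurable_action (G : topologicalGroupType) (X : ptopologicalType)
    (act : G -> X -> X) : Prop :=
  [/\ forall x, act 1%g x = x,
      forall g h x, act (g * h)%g x = act g (act h x) &
      measurable_fun [set: borelType G * borelType X]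
        ((fun gx => act gx.1 gx.2) : borelType G * borelType X -> borelType X)].

Definition invariant_under (R : realType) (G : topologicalGroupType)
    (X : ptopologicalType) (act : G -> X -> X)
    (m : {measure set (borelType X) -> \bar R}) : Prop :=
  forall (g : G) (A : set (borelType X)), measurable A ->
    m [set act g x | x in (A : set X)] = m A.

Definition has_density d (T : measurableType d) (R : realType)
    (pi m : {measure set T -> \bar R}) : Prop :=
  exists p : T -> R,
    [/\ measurable_fun setT p, (forall x, 0 <= p x) &
        forall A, measurable A -> pi A = (\int[m]_(x in A) (p x)%:E)%E].

Section L2.
Context d (T : measurableType d) (R : realType).
Variable pi : {measure set T -> \bar R}.

(* Elements of L^2(pi) are represented by functions in Lfun pi 2 and equality
   in L^2(pi) by pi-a.e. equality; an operator on L^2(pi) is accordingly a map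
   on functions, whose values outside Lfun pi 2 are irrelevant. *)
Notation L2 := (Lfun pi 2%:E).

Definition inner2 (f g : T -> R) : R := \int[pi]_x (f x * g x).

Definition norm2 (f : T -> R) : \bar R := ('N[pi]_(2%:E) [EFin \o f])%E.

Definition L20 : set (T -> R) := [set f | f \in L2 /\ \int[pi]_x f x = 0].

Definition bounded_operator (S : (T -> R) -> (T -> R)) : Prop :=
  [/\ (forall f, f \in L2 -> S f \in L2),
      (forall f g, f \in L2 -> g \in L2 ->
         f = g %[ae pi] -> S f = S g %[ae pi]),
      (forall (a : R) f g, f \in L2 -> g \in L2 ->
         S (a *: f + g) = a *: S f + S g %[ae pi]) &
      (exists C : R, forall f, f \in L2 -> (norm2 (S f) <= C%:E * norm2 f)%E)].

Definition compact_operator (S : (T -> R) -> (T -> R)) : Prop :=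
  bounded_operator S /\
  forall f_ : nat -> (T -> R),
    (forall n, f_ n \in L2 /\ (norm2 (f_ n) <= 1)%E) ->
    exists (s : nat -> nat) (g : T -> R),
      [/\ {homo s : m n / (m < n)%N}, g \in L2 &
          norm2 (S (f_ (s n)) - g) @[n --> \oo] --> 0%E].

Definition is_adjoint (S S' : (T -> R) -> (T -> R)) : Prop :=
  bounded_operator S' /\
  forall f g, f \in L2 -> g \in L2 -> inner2 (S f) g = inner2 f (S' g).

(* The adjoint and the positive square root are picked by choice; each is
   unique up to a.e. equality of its values when it exists. *)
Definition adjoint (S : (T -> R) -> (T -> R)) : (T -> R) -> (T -> R) :=
  @xget {classic ((T -> R) -> (T -> R))} id [set S' | is_adjoint S S'].

(* Over the reals positivity of the quadratic form does not imply symmetry. *)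
Definition is_sqrt_operator (A S : (T -> R) -> (T -> R)) : Prop :=
  [/\ bounded_operator S,
      (forall f g, f \in L2 -> g \in L2 -> inner2 (S f) g = inner2 f (S g)),
      (forall f, f \in L2 -> 0 <= inner2 f (S f)) &
      (forall f, f \in L2 -> S (S f) = A f %[ae pi])].

Definition sqrt_operator (A : (T -> R) -> (T -> R)) : (T -> R) -> (T -> R) :=
  @xget {classic ((T -> R) -> (T -> R))} id [set S | is_sqrt_operator A S].

Definition spectral_gap (S : (T -> R) -> (T -> R)) : \bar R :=
  ereal_inf [set (inner2 f (f - sqrt_operator (S \o adjoint S) f))%:E
            | f in [set f | L20 f /\ norm2 f = 1%E]].

End L2.

Section kernels.
Context d (T : measurableType d) (R : realType).

Definition kernel_operator (P : R.-pker T ~> T) (f : T -> R) : T -> R :=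
  fun x => \int[P x]_y f y.

Definition stationary (pi : {measure set T -> \bar R}) (P : R.-pker T ~> T) :
    Prop :=
  forall A, measurable A -> (\int[pi]_x P x A)%E = pi A.

End kernels.

Section averaging.
Context (R : realType) (G : topologicalGroupType) (X : ptopologicalType).
Variable act : G -> X -> X.

Definition U_ (g : G) (f : X -> R) : X -> R := fun x => f (act g x).

(* sigma-algebra on G * G: the product of the Borel sigma-algebras. A Borel
   measure on the topological space G * G restricts to it, and the average
   only depends on that restriction. *)
Definition P_da (P : R.-pker (borelType X) ~> (borelType X))
    (nu : {measure set (borelType G * borelType G)%type -> \bar R})
    (f : X -> R) : X -> R :=
  fun x => \int[nu]_gh (U_ gh.1 (kernel_operator P (U_ gh.2 f)) x).

Definition P_la_ra (P : R.-pker (borelType X) ~> (borelType X))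
    (mu : probability (borelType G) R) : (X -> R) -> (X -> R) :=
  P_da P (mu \x mu)%E.

End averaging.

(* Main.v *)
Require Import Defs.
From HB Require Import structures.
From mathcomp Require Import all_boot all_order all_algebra.
From mathcomp Require Import all_classical all_reals all_analysis.
From mathcomp Require Import ring lra measurable_realfun.
Import Order.TTheory GRing.Theory Num.Theory.
Import numFieldNormedType.Exports.
Local Open Scope classical_set_scope.
Local Open Scope ring_scope.

Set Implicit Arguments.
Unset Strict Implicit.
Unset Printing Implicit Defensive.

(** Write A for P_da act P nu, B for P_la_ra act P mu, and Q for the average
    f |-> (x |-> \int[mu]_g f (act g x)) over orbits. The point is that
    B = Q A Q on L^2(pi), whatever nu is. Indeed Q f is constant on orbits, so
    U_ h (Q f) = Q f, and Q (U_ g w) = Q w by left invariance of mu; hence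
    Q (U_ g P U_ h) Q = Q P Q for all g and h. Averaging over nu gives
    Q A Q = Q P Q, and taking for nu the product of mu with itself identifies
    Q P Q with B.

    All these operators come from Markov kernels that preserve pi. They are
    therefore contractions (Jensen), fix the constant 1 and preserve integrals.
    From B = Q A Q one gets |B^* f| <= |A^* Q^* f|, and |A^* h|
    is the norm of |A^*| h for |A^*| = sqrt (A A^* ), likewise for B. A positive
    symmetric operator whose quadratic form is at most s on the unit sphere of
    an invariant subspace has norm at most s there; with s = 1 - gamma(A) on
    L^2_0(pi), this yields <f, |B^*| f> <= s for every unit f of mean zero, that
    is, gamma(B) >= gamma(A) (spectral_gap_compression).

    The adjoint and the square root in the definition of the gap are chosen
    among the operators with the right properties, so they have to be shown to
    exist: the adjoint by the Riesz representation theorem, the square root as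
    I - Y where Y is the limit of the iteration Y |-> (D + Y^2) / 2 with
    D = I - A A^*. Both rest on the completeness of L^2(pi)
    (L2inner_complete).

    Invariance of Q f under the group is a right invariance of mu. The group is
    not assumed second countable, so its multiplication need not be measurable
    for the product of the Borel sigma-algebras, and the usual uniqueness
    argument for Haar measure does not apply as such. It does apply to functions
    of the form g |-> f (act g x), which is all that Q involves
    (orbit_mean_invariant). *)

(** * Complete semi-inner product spaces *)

Lemma quadratic_ge0_discr (R : realFieldType) (a b c : R) : 0 <= a ->
  (forall t, 0 <= t ^+ 2 * a + 2 * t * b + c) -> b ^+ 2 <= a * c.
Proof.
rewrite le_eqVlt => /predU1P[<-|a0] H.
  have [->|b0] := eqVneq b 0; first by rewrite expr0n mul0r.
  have := H (- (c + 1) / (2 * b)).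
  suff -> : (- (c + 1) / (2 * b)) ^+ 2 * 0 + 2 * (- (c + 1) / (2 * b)) * b + c = -1.
    by rewrite oppr_ge0 ler10.
  by field.
have := H (- b / a).
have -> : (- b / a) ^+ 2 * a + 2 * (- b / a) * b + c = (a * c - b ^+ 2) / a.
  by field; rewrite gt_eqF.
by rewrite pmulr_lge0 ?invr_gt0// subr_ge0.
Qed.

(** Degenerate forms are allowed: vectors will be functions, and those that
    vanish almost everywhere are null. Equality in the Hilbert space is replaced
    by equality of all products, see si_eqP. *)
Definition semi_inner (R : realType) (V : lmodType R) (b : V -> V -> R) : Prop :=
  [/\ forall a x y z, b (a *: x + y) z = a * b x z + b y z,
      forall x y, b x y = b y x & forall x, 0 <= b x x].

Section semi_inner_theory.
Context (R : realType) (V : lmodType R) (b : V -> V -> R).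
Hypothesis sb : semi_inner b.

Lemma si_sym x y : b x y = b y x. Proof. by case: sb. Qed.
Lemma si_ge0 x : 0 <= b x x. Proof. by case: sb. Qed.
Lemma si_linearl a x y z : b (a *: x + y) z = a * b x z + b y z.
Proof. by case: sb. Qed.
Lemma si_linearr a x y z : b z (a *: x + y) = a * b z x + b z y.
Proof. by rewrite si_sym si_linearl !(si_sym z). Qed.
Lemma siDl x y z : b (x + y) z = b x z + b y z.
Proof. by rewrite -[x]scale1r si_linearl scale1r mul1r. Qed.
Lemma si0l z : b 0 z = 0.
Proof. by have := siDl 0 0 z; rewrite addr0 => /eqP; rewrite addrC -subr_eq subrr => /eqP. Qed.
Lemma siZl a x z : b (a *: x) z = a * b x z.
Proof. by rewrite -[a *: x]addr0 si_linearl si0l addr0. Qed.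
Lemma siBl x y z : b (x - y) z = b x z - b y z.
Proof. by rewrite addrC -scaleN1r si_linearl mulN1r addrC. Qed.
Lemma siBr x y z : b z (x - y) = b z x - b z y.
Proof. by rewrite si_sym siBl !(si_sym z). Qed.
Lemma siZr a x z : b z (a *: x) = a * b z x.
Proof. by rewrite si_sym siZl si_sym. Qed.

Lemma si_cauchy_schwarz x y : b x y ^+ 2 <= b x x * b y y.
Proof.
apply: quadratic_ge0_discr => [|t]; first exact: si_ge0.
have := si_ge0 (t *: x + y); rewrite si_linearl !si_linearr (si_sym y x).
by rewrite (_ : _ + _ + _ = t * (t * b x x + b x y) + (t * b x y + b y y))//; ring.
Qed.

Lemma si_null x : b x x = 0 -> forall y, b x y = 0.
Proof.
move=> x0 y; have := si_cauchy_schwarz x y; rewrite x0 mul0r => h.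
by apply/eqP; rewrite -sqrf_eq0 eq_le h sqr_ge0.
Qed.

Lemma si_eqP x y : (forall z, b x z = b y z) <-> b (x - y) (x - y) = 0.
Proof.
split=> [h|/si_null h z]; first by rewrite siBl h subrr.
by apply/eqP; rewrite -subr_eq0 -siBl h.
Qed.

End semi_inner_theory.

Definition si_complete (R : realType) (V : lmodType R) (b : V -> V -> R) :=
  forall u : nat -> V,
    (forall e : R, 0 < e -> exists N, forall m n, (N <= m)%N -> (N <= n)%N ->
        b (u m - u n) (u m - u n) < e) ->
    exists x, b (u n - x) (u n - x) @[n --> \oo] --> (0 : R).

(** Linearity in the quotient by the null vectors, which is all that can be asked
    of an operator defined up to almost everywhere equality. *)
Definition weakly_linear (R : realType) (V : lmodType R) (b : V -> V -> R)
    (S : V -> V) :=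
  forall a x y z, b (S (a *: x + y)) z = a * b (S x) z + b (S y) z.

Definition adjoint_pair (R : realType) (V : lmodType R) (b : V -> V -> R)
  (S S' : V -> V) := forall x y, b (S x) y = b x (S' y).

Definition contractive (R : realType) (V : lmodType R) (b : V -> V -> R)
  (S : V -> V) := forall x, b (S x) (S x) <= b x x.

Section riesz.
Context (R : realType) (V : lmodType R) (b : V -> V -> R).
Hypotheses (sb : semi_inner b) (cb : si_complete b).

Lemma si_weak_cvg u x y : b (u n - x) (u n - x) @[n --> \oo] --> (0 : R) ->
  b (u n) y @[n --> \oo] --> b x y.
Proof.
move=> ux; apply/cvgrPdist_lt => e e0.
have K0 : 0 < e ^+ 2 / (b y y + 1).
  by rewrite divr_gt0 ?exprn_gt0// ltr_wpDl// (si_ge0 sb).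
have /cvgrPdist_lt/(_ _ K0) := ux.
apply: filterS => n; rewrite sub0r normrN ger0_norm ?(si_ge0 sb)// => h.
rewrite -(@ltr_pXn2r _ 2)// ?nnegrE ?(ltW e0)//.
rewrite -normrX ger0_norm ?sqr_ge0// -(siBl sb) -sqrrN -mulN1r -(siZl sb) scaleN1r opprB.
rewrite (le_lt_trans (si_cauchy_schwarz sb _ _))//.
move: h; rewrite ltr_pdivlMr ?ltr_wpDl ?(si_ge0 sb)//.
by apply: le_lt_trans; rewrite ler_wpM2l ?(si_ge0 sb)// lerDl.
Qed.

(** The quadratic functional J x = b x x - 2 l x is minimal exactly at a
    representing vector. An approximate minimizer represents l approximately, by
    a discriminant argument, and approximate representing vectors are close to
    each other; so a minimizing sequence is Cauchy and its limit represents l. *)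
Lemma riesz_representation (l : V -> R) (K : R) : 0 <= K ->
  (forall a x y, l (a *: x + y) = a * l x + l y) ->
  (forall x, l x ^+ 2 <= K * b x x) ->
  exists v, forall z, b v z = l z.
Proof.
move=> K0 ll lK.
pose J x := b x x - 2 * l x.
have JK x : - K <= J x.
  have := lK x; have := si_ge0 sb x; rewrite /J => b0 lx.
  suff : 2 * l x <= b x x + K by lra.
  apply: (le_trans (ler_norm _)).
  rewrite -(@ler_pXn2r _ 2)// ?nnegrE ?addr_ge0// -normrX ger0_norm ?sqr_ge0//.
  have := sqr_ge0 (b x x - K).
  by nra.
have JE t v z : J (t *: z + v) = J v + (t ^+ 2 * b z z + 2 * t * (b v z - l z)).
  by rewrite /J ll (si_linearl sb) !(si_linearr sb) (si_sym sb z v); ring.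
have Jinf : has_inf (range J).
  by split; [exists (J 0), 0|exists (- K) => _ [x _ <-]; exact: JK].
pose m := inf (range J).
have mJ x : m <= J x by apply: ge_inf; [case: Jinf|exists x].
have approx (e : R) : 0 < e -> exists v, forall z, (b v z - l z) ^+ 2 <= b z z * e.
  move=> e0; have [_ [v _ <-] Jv] := inf_adherent e0 Jinf.
  exists v => z; apply: quadratic_ge0_discr => [|t]; first exact: si_ge0.
  by have := mJ (t *: z + v); rewrite JE; move: Jv; rewrite -/m; lra.
have /choice[u uP] (n : nat) : exists v, forall z,
    (b v z - l z) ^+ 2 <= b z z * n.+1%:R^-1 by apply: approx; rewrite invr_gt0.
have uu m' n : b (u m' - u n) (u m' - u n) <= 2 * (m'.+1%:R^-1 + n.+1%:R^-1).
  set z := u m' - u n; have z0 := si_ge0 sb z.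
  have := uP m' z; have := uP n z.
  have : b z z = (b (u m') z - l z) - (b (u n) z - l z).
    by rewrite {1}/z (siBl sb) opprB addrA subrK.
  set p := b _ _ - l z; set q := b _ _ - l z; set e := _^-1; set f := _^-1.
  move=> zpq hq hp.
  have : b z z ^+ 2 <= b z z * (2 * (f + e)).
    by rewrite {1}zpq; have := sqr_ge0 (p + q); nra.
  have [->|zn0] := eqVneq (b z z) 0; first by rewrite mulr_ge0// addr_ge0// invr_ge0.
  by rewrite expr2 ler_pM2l// lt_neqAle eq_sym zn0.
have [e e0|v uv] := @cb u.
  have e4 : 0 < e / 4 by rewrite divr_gt0.
  have [N _ HN] := near_infty_natSinv_lt (PosNum e4).
  exists N => i j Ni Nj; apply: (le_lt_trans (uu i j)).
  have -> : e = 2 * (e / 4 + e / 4) by field.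
  by rewrite ltr_pM2l// ltrD//; [exact: HN i Ni|exact: HN j Nj].
exists v => z; have uvz := @si_weak_cvg _ _ z uv.
apply: (cvg_unique (@Rhausdorff R) uvz).
apply/cvgrPdist_lt => e e0.
have z1 : 0 < b z z + 1 by rewrite ltr_wpDl// (si_ge0 sb).
have ez : 0 < e ^+ 2 / (b z z + 1) by rewrite divr_gt0// exprn_gt0.
near=> n.
rewrite distrC -(@ltr_pXn2r _ 2)// ?nnegrE ?(ltW e0)//.
rewrite -normrX ger0_norm ?sqr_ge0//.
apply: (le_lt_trans (uP n z)).
rewrite (@le_lt_trans _ _ ((b z z + 1) / n.+1%:R))//.
  by rewrite ler_pM2r ?invr_gt0// lerDl.
rewrite mulrC -ltr_pdivlMr//.
by near: n; exact: (near_infty_natSinv_lt (PosNum ez)).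
Unshelve. all: by end_near. Qed.

(** Stated for the second member of any adjoint pair; in particular a symmetric
    operator is weakly linear. *)
Lemma adjoint_weakly_linear S S' : adjoint_pair b S S' -> weakly_linear b S'.
Proof.
move=> SS' a x y z.
by rewrite !(si_sym sb (S' _)) -!SS' (si_linearr sb).
Qed.

Lemma adjoint_pair_sym S S' : adjoint_pair b S S' -> adjoint_pair b S' S.
Proof. by move=> SS' x y; rewrite (si_sym sb) -SS' (si_sym sb). Qed.

Lemma adjoint_exists S : weakly_linear b S -> contractive b S ->
  exists S', adjoint_pair b S S'.
Proof.
move=> Sl Sc.
have /choice[S' HS'] (y : V) : exists v, forall x, b v x = b (S x) y.
  apply: (@riesz_representation _ (b y y)) => [|a x z|x].
  - exact: si_ge0.
  - by rewrite Sl.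
  - rewrite mulrC (le_trans (si_cauchy_schwarz sb _ _))//.
    by rewrite ler_wpM2r ?(si_ge0 sb).
by exists S' => x y; rewrite (si_sym sb x) HS'.
Qed.

Lemma adjoint_contractive S S' : contractive b S -> adjoint_pair b S S' ->
  contractive b S'.
Proof.
move=> Sc SS' y.
have := si_cauchy_schwarz sb (S (S' y)) y; rewrite SS'.
have [->|n0] := eqVneq (b (S' y) (S' y)) 0; first by rewrite (si_ge0 sb).
have p0 : 0 < b (S' y) (S' y) by rewrite lt_neqAle eq_sym n0 (si_ge0 sb).
move=> /le_trans/(_ (ler_wpM2r (si_ge0 sb y) (Sc _))).
by rewrite expr2 ler_pM2l.
Qed.

(** A linear contraction sends null vectors to null vectors, hence is defined on
    the quotient. *)
Lemma contractive_ext S x y : weakly_linear b S -> contractive b S ->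
  (forall z, b x z = b y z) -> forall z, b (S x) z = b (S y) z.
Proof.
move=> Sl Sc /(si_eqP sb) xy z.
have : b (S (-1 *: y + x)) z = 0.
  apply: (si_null sb); apply/eqP; rewrite eq_le si_ge0// andbT -xy.
  by rewrite scaleN1r [X in S X]addrC; exact: Sc.
by rewrite Sl mulN1r addrC => /eqP; rewrite subr_eq0 => /eqP.
Qed.

End riesz.

Section positive_bound.
Context (R : realType) (V : lmodType R) (b : V -> V -> R) (S : V -> V).
Hypotheses (sb : semi_inner b) (Ss : adjoint_pair b S S)
  (Sp : forall x, 0 <= b x (S x)).

(** Cauchy-Schwarz for the form (x, y) |-> b x (S y), applied to S x and x: a
    bound on the form gives a bound on the norm. The bound is needed only at the
    two vectors x and S x, so the lemma applies on an invariant subspace. *)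
Lemma positive_operator_bound (s : R) x :
  b x (S x) <= s * b x x -> b (S x) (S (S x)) <= s * b (S x) (S x) ->
  b (S x) (S x) <= s ^+ 2 * b x x.
Proof.
move=> h1 h2.
have form : semi_inner (fun x y => b x (S y)).
  split=> [a u v z|u v|u]; first by rewrite (si_linearl sb).
    by rewrite -Ss (si_sym sb).
  exact: Sp.
have := si_cauchy_schwarz form (S x) x.
have [->|n0] := eqVneq (b (S x) (S x)) 0.
  by rewrite mulr_ge0 ?sqr_ge0// (si_ge0 sb).
have p0 : 0 < b (S x) (S x) by rewrite lt_neqAle eq_sym n0 (si_ge0 sb).
rewrite /= expr2 => h; rewrite -(ler_pM2l p0); apply: (le_trans h).
apply: (le_trans (ler_pM (Sp _) (Sp _) h2 h1)).
by rewrite le_eqVlt; apply/orP; left; apply/eqP; ring.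
Qed.
End positive_bound.

(** The linear functional on polynomials that sends X^i to c i. With
    c i = b (D^i x) y it computes b (p(D) x) y, so that identities between
    polynomials transfer to a symmetric operator D without composing operators. *)
Definition moment (R : realType) (c : nat -> R) (p : {poly R}) : R :=
  \sum_(i < size p) p`_i * c i.

Definition nonneg_coefs (R : realType) (p : {poly R}) := forall i, 0 <= p`_i.

Section moment.
Context (R : realType).
Implicit Types (c : nat -> R) (p q : {poly R}).

Lemma moment_widen c p n : (size p <= n)%N -> moment c p = \sum_(i < n) p`_i * c i.
Proof.
move=> pn; rewrite /moment (big_ord_widen n (fun i => p`_i * c i))// big_mkcond.
by apply: eq_bigr => i _; case: ltnP => // pi; rewrite nth_default// mul0r.
Qed.

Lemma moment_linear c a p q : moment c (a *: p + q) = a * moment c p + moment c q.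
Proof.
pose n := maxn (size (a *: p + q)) (maxn (size p) (size q)).
rewrite !(@moment_widen c _ n) ?leq_max ?leqnn ?orbT// mulr_sumr -big_split.
by apply: eq_bigr => i _; rewrite coefD coefZ /=; ring.
Qed.

Lemma moment0 c : moment c 0 = 0.
Proof. by rewrite /moment size_poly0 big_ord0. Qed.

Lemma momentD c p q : moment c (p + q) = moment c p + moment c q.
Proof. by rewrite -[p]scale1r moment_linear scale1r mul1r. Qed.

Lemma momentZ c a p : moment c (a *: p) = a * moment c p.
Proof. by rewrite -[a *: p]addr0 moment_linear moment0 addr0. Qed.

Lemma momentB c p q : moment c (p - q) = moment c p - moment c q.
Proof. by rewrite momentD -scaleN1r momentZ mulN1r. Qed.

Lemma momentXn c n p : moment c ('X^n * p) = moment (fun i => c (n + i)%N) p.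
Proof.
rewrite (@moment_widen c _ (n + size p)%N); last first.
  by rewrite (leq_trans (size_polyMleq _ _))// size_polyXn.
rewrite big_split_ord /= big1 ?add0r => [|i _]; last by rewrite coefXnM ltn_ord mul0r.
by apply: eq_bigr => i _; rewrite coefXnM ltnNge leq_addr addKn.
Qed.

Lemma momentM c p q :
  moment c (p * q) = \sum_(i < size p) p`_i * moment (fun j => c (i + j)%N) q.
Proof.
rewrite -{1}[p]coefK poly_def mulr_suml.
rewrite (big_morph _ (momentD c) (moment0 c)).
by apply: eq_bigr => i _; rewrite -scalerAl momentZ momentXn.
Qed.

Lemma moment_le c p K : nonneg_coefs p -> (forall i, c i <= K) ->
  moment c p <= p.[1] * K.
Proof.
move=> p0 cK; rewrite horner_coef mulr_suml ler_sum// => i _.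
by rewrite expr1n mulr1 ler_wpM2l.
Qed.

Lemma nonneg_coefsD p q : nonneg_coefs p -> nonneg_coefs q -> nonneg_coefs (p + q).
Proof. by move=> p0 q0 i; rewrite coefD addr_ge0. Qed.

Lemma nonneg_coefsM p q : nonneg_coefs p -> nonneg_coefs q -> nonneg_coefs (p * q).
Proof. by move=> p0 q0 i; rewrite coefM sumr_ge0// => j _; rewrite mulr_ge0. Qed.

Lemma nonneg_coefsZ a p : 0 <= a -> nonneg_coefs p -> nonneg_coefs (a *: p).
Proof. by move=> a0 p0 i; rewrite coefZ mulr_ge0. Qed.

Lemma nonneg_coefs_horner1 p : nonneg_coefs p -> 0 <= p.[1].
Proof. by move=> p0; rewrite horner_coef sumr_ge0// => i _; rewrite expr1n mulr1. Qed.

(** 1 - sqrt (1 - X) is the fixed point of p |-> (X + p^2) / 2; these are the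
    iterates from 0. *)
Fixpoint sqrt_poly (n : nat) : {poly R} :=
  if n is n'.+1 then 2^-1 *: ('X + sqrt_poly n' ^+ 2) else 0.

Lemma sqrt_polyS n : sqrt_poly n.+1 = 2^-1 *: ('X + sqrt_poly n ^+ 2).
Proof. by []. Qed.

Lemma sqrt_poly_ge0 n : nonneg_coefs (sqrt_poly n).
Proof.
elim: n => [|n IH] /=; first by move=> i; rewrite coef0.
apply: nonneg_coefsZ; first by rewrite invr_ge0.
by apply: nonneg_coefsD; [move=> i; rewrite coefX ler0n|exact: nonneg_coefsM].
Qed.

(** The increments satisfy 2 d_(n+1) = (p_(n+1) + p_n) d_n, so nonnegativity
    of their coefficients propagates. *)
Lemma sqrt_poly_step n : nonneg_coefs (sqrt_poly n.+1 - sqrt_poly n).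
Proof.
elim: n => [|n IH]; first by rewrite /= subr0; exact: (sqrt_poly_ge0 1).
rewrite [sqrt_poly n.+2]sqrt_polyS {2}[sqrt_poly n.+1]sqrt_polyS.
rewrite -scalerBr opprD addrACA subrr add0r subr_sqr.
apply: nonneg_coefsZ; first by rewrite invr_ge0.
by apply: nonneg_coefsM => //; apply: nonneg_coefsD; exact: sqrt_poly_ge0.
Qed.

Lemma sqrt_poly_incr m n : (m <= n)%N -> nonneg_coefs (sqrt_poly n - sqrt_poly m).
Proof.
elim: n => [|n IH]; first by rewrite leqn0 => /eqP-> i; rewrite subrr coef0.
rewrite leq_eqVlt ltnS => /predU1P[->i|/IH mn]; first by rewrite subrr coef0.
rewrite -(subrKA (sqrt_poly n)); apply: nonneg_coefsD => //.
exact: sqrt_poly_step.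
Qed.

Lemma sqrt_poly1_le1 n : (sqrt_poly n).[1] <= 1.
Proof.
elim: n => [|n IH]; first by rewrite /= horner0.
have := nonneg_coefs_horner1 (@sqrt_poly_ge0 n).
by rewrite sqrt_polyS !hornerE; move: IH; set a := _.[1]; nra.
Qed.

Lemma sqrt_poly1_incr m n : (m <= n)%N -> (sqrt_poly m).[1] <= (sqrt_poly n).[1].
Proof.
by move=> /sqrt_poly_incr/nonneg_coefs_horner1; rewrite hornerD hornerN subr_ge0.
Qed.

Lemma cvg_sqrt_poly1 : cvgn (fun n => (sqrt_poly n).[1]).
Proof.
apply: nondecreasing_is_cvgn; first by move=> m n; exact: sqrt_poly1_incr.
by exists 1 => _ [n _ <-]; exact: sqrt_poly1_le1.
Qed.

End moment.

Section square_root.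
Context (R : realType) (V : lmodType R) (b : V -> V -> R).
Hypotheses (sb : semi_inner b) (cb : si_complete b).

(** Joint continuity of the form, from b u w = b (u - x) (w - y) + b u y + b w x
    - b x y, whose first term is at most the sum of the squared distances. *)
Lemma si_strong_cvg u w x y :
  b (u n - x) (u n - x) @[n --> \oo] --> (0 : R) ->
  b (w n - y) (w n - y) @[n --> \oo] --> (0 : R) ->
  b (u n) (w n) @[n --> \oo] --> b x y.
Proof.
move=> ux wy.
have bE n : b (u n) (w n) = b (u n - x) (w n - y) + (b (u n) y + b (w n) x - b x y).
  by rewrite (siBl sb) !(siBr sb) (si_sym sb (w n) x); ring.
rewrite (_ : (fun n => _) = fun n => b (u n - x) (w n - y) + (b (u n) y + b (w n) x - b x y)); last first.
  by apply/funext => n.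
have w1 := @si_weak_cvg _ _ _ sb _ _ y ux; have w2 := @si_weak_cvg _ _ _ sb _ _ x wy.
rewrite -[X in _ --> X]add0r -[X in _ --> _ + X](addrK (b x y)).
apply: cvgD; last first.
  apply: cvgB; last exact: (cvg_cst (b x y)).
  apply: cvgD; first exact: w1.
  by rewrite (si_sym sb x); exact: w2.
have uw : b (u n - x) (u n - x) + b (w n - y) (w n - y) @[n --> \oo] --> (0 : R).
  by rewrite -[X in _ --> X]addr0; exact: cvgD.
have uwN : - (b (u n - x) (u n - x) + b (w n - y) (w n - y)) @[n --> \oo] --> (0 : R).
  by rewrite -oppr0; exact: cvgN.
apply: squeeze_cvgr uwN uw.
near=> n.
have := si_cauchy_schwarz sb (u n - x) (w n - y).
have := si_ge0 sb (u n - x); have := si_ge0 sb (w n - y).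
set p := b (u n - x) (w n - y); set q := b (u n - x) _; set r := b _ _ => r0 q0 h.
rewrite -ler_norml -(@ler_pXn2r _ 2)// ?nnegrE ?addr_ge0// -normrX ger0_norm ?sqr_ge0//.
by apply: (le_trans h); nra.
Unshelve. all: by end_near. Qed.

Section polynomial.
Variable D : V -> V.
Hypotheses (Ds : adjoint_pair b D D) (Dc : contractive b D).

Definition poly_op (p : {poly R}) (x : V) : V :=
  \sum_(i < size p) p`_i *: iter i D x.

Lemma si_suml n (v : 'I_n -> V) y : b (\sum_i v i) y = \sum_i b (v i) y.
Proof.
by apply: (big_morph (b ^~ y)) => [u w|]; [exact: siDl|exact: si0l].
Qed.

Lemma iter_sym i x y : b (iter i D x) y = b x (iter i D y).
Proof. by elim: i x y => //= i IH x y; rewrite Ds IH -iterSr. Qed.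

Lemma poly_opE p q x y : b (poly_op p x) (poly_op q y) =
  moment (fun i => b (iter i D x) y) (p * q).
Proof.
rewrite momentM si_suml; apply: eq_bigr => i _.
rewrite (siZl sb) (si_sym sb) si_suml; congr (_ * _); apply: eq_bigr => j _.
by rewrite (siZl sb) iter_sym -iterD (si_sym sb) addnC iter_sym.
Qed.

Lemma poly_op1 x : poly_op 1 x = x.
Proof. by rewrite /poly_op size_poly1 big_ord1 coef1 scale1r. Qed.

Lemma poly_op_l p x y : b (poly_op p x) y = moment (fun i => b (iter i D x) y) p.
Proof. by rewrite -{1}[y]poly_op1 poly_opE mulr1. Qed.

Lemma iter_contractive i : contractive b (iter i D).
Proof. by elim: i => [|i IH] x //=; exact: le_trans (Dc _) (IH _). Qed.

(** From |D^i x - x|^2 >= 0 and |D^i x| <= |x|. *)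
Lemma iter_le i x : b (iter i D x) x <= b x x.
Proof.
have := si_ge0 sb (iter i D x - x); rewrite (siBl sb) !(siBr sb).
have := iter_contractive i x; rewrite (si_sym sb x (iter _ _ _)).
move: (b _ _) (b _ _) (b x x) => p q r; lra.
Qed.

Lemma poly_op_le p x : nonneg_coefs p -> b (poly_op p x) x <= p.[1] * b x x.
Proof. by move=> p0; rewrite poly_op_l moment_le// => i; exact: iter_le. Qed.

Let u x n := poly_op (sqrt_poly R n) x.

(** The difference of two iterates has nonnegative coefficients, so the norm of
    its value at D is bounded by its value at 1, and the values of the iterates
    at 1 increase to a limit. *)
Let u_cauchy x (e : R) : 0 < e -> exists N, forall m n, (N <= m)%N -> (N <= n)%N ->
  b (u x m - u x n) (u x m - u x n) < e.
Proof.
move=> e0.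
have uE m n : b (u x m - u x n) (u x m - u x n) =
    moment (fun i => b (iter i D x) x) ((sqrt_poly R m - sqrt_poly R n) ^+ 2).
  rewrite (siBl sb) !(siBr sb) !poly_opE -!momentB; congr (moment _ _); ring.
have K1 : 0 < b x x + 1 by rewrite ltr_wpDl// (si_ge0 sb).
have ek : 0 < e / (b x x + 1) by rewrite divr_gt0.
have /cvgrPdist_lt/(_ _ ek)[N _ HN] := @cvg_sqrt_poly1 R.
have le_uu m n : (N <= n)%N -> (n <= m)%N -> b (u x m - u x n) (u x m - u x n) < e.
  move=> Nn nm; rewrite uE.
  have pos := @sqrt_poly_incr R _ _ nm.
  apply: (le_lt_trans (moment_le (nonneg_coefsM pos pos) (fun i => iter_le i x))).
  rewrite hornerM hornerD hornerN.
  have a0 := nonneg_coefs_horner1 (@sqrt_poly_ge0 R n).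
  have a1 := @sqrt_poly1_le1 R m.
  have a2 := sqrt_poly1_incr R nm.
  have al : (sqrt_poly R m).[1] <= limn (fun n => (sqrt_poly R n).[1]).
    apply: (nondecreasing_cvgn_le _ (@cvg_sqrt_poly1 R)) => i j.
    exact: sqrt_poly1_incr.
  have := HN n Nn; rewrite /= ger0_norm; last by rewrite subr_ge0 (le_trans a2).
  rewrite ltr_pdivlMr//; apply: le_lt_trans.
  rewrite ler_pM ?(si_ge0 sb)// ?mulr_ge0 ?subr_ge0// ?lerDl//.
  by rewrite (le_trans (ler_piMl _ _)) ?subr_ge0// ?lerB// lerBlDr (le_trans a1)// lerDl.
exists N => m n Nm Nn; have [nm|/ltnW mn] := leqP n m; first exact: le_uu.
rewrite -opprB -scaleN1r (siZl sb) (siZr sb) mulrA mulrNN !mul1r.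
exact: le_uu.
Qed.

Lemma poly_op_sym p : adjoint_pair b (poly_op p) (poly_op p).
Proof.
by move=> x y; rewrite poly_op_l -{2}[x]poly_op1 poly_opE mul1r.
Qed.

Lemma moment_X (c : nat -> R) : moment c 'X = c 1%N.
Proof. by rewrite /moment size_polyX big_ord_recl big_ord1 !coefX/= mul0r mul1r add0r. Qed.

(** The limit Y of p_n(D) gives S = I - Y. The square (1 - p_n)^2 is
    1 - X + 2 (p_(n+1) - p_n), by the recursion for p_n, and the last term tends
    to 0 at D; hence S^2 = I - D. Positivity of S holds because p_n(1) <= 1. *)
Lemma sqrt_one_minus : exists S,
  [/\ adjoint_pair b S S, (forall x, 0 <= b x (S x)) &
      forall x y, b (S (S x)) y = b x y - b (D x) y].
Proof.
have /choice[Y HY] (x : V) := cb (u_cauchy x).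
have wY x y : b (u x n) y @[n --> \oo] --> b (Y x) y by apply: si_weak_cvg.
have Ys : adjoint_pair b Y Y.
  move=> x y; apply: (cvg_unique (@Rhausdorff R) (wY x y)).
  rewrite (_ : (fun n => _) = fun n => b (u y n) x); first by rewrite (si_sym sb x); exact: wY.
  by apply/funext => n; rewrite (poly_op_sym _ x) (si_sym sb).
have Ss : adjoint_pair b (fun x => x - Y x) (fun x => x - Y x).
  by move=> x y; rewrite (siBl sb) (siBr sb) Ys.
exists (fun x => x - Y x); split=> // [x|x y].
  rewrite (siBr sb) subr_ge0 (si_sym sb).
  apply: (ler_cvg_to (wY x x) (cvg_cst (b x x))).
  near=> n; rewrite (le_trans (poly_op_le _ (@sqrt_poly_ge0 _ n)))//.
  by rewrite ler_piMl ?(si_ge0 sb)// sqrt_poly1_le1.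
rewrite Ss.
have cS z : b ((z - u z n) - (z - Y z)) ((z - u z n) - (z - Y z)) @[n --> \oo] --> (0 : R).
  rewrite (_ : (fun n => _) = fun n => b (u z n - Y z) (u z n - Y z)); first exact: HY.
  apply/funext => n; rewrite opprB addrC addrA subrK.
  by rewrite !(siBl sb) !(siBr sb) (si_sym sb (Y z)); ring.
apply: (cvg_unique (@Rhausdorff R) (si_strong_cvg (cS x) (cS y))).
set c := fun i => b (iter i D x) y.
rewrite (_ : (fun n => _) = fun n => b x y - b (D x) y + 2 * (b (u x n.+1) y - b (u x n) y)); last first.
  apply/funext => n; rewrite (siBl sb) !(siBr sb) -(poly_op_sym _ x y).
  rewrite poly_opE !poly_op_l -/c sqrt_polyS momentZ momentD moment_X.
  by rewrite /c /= -expr2; field.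
have : b x y - b (D x) y + 2 * (b (u x n.+1) y - b (u x n) y) @[n --> \oo]
    --> b x y - b (D x) y + 2 * (b (Y x) y - b (Y x) y).
  apply: cvgD; first exact: (cvg_cst (b x y - b (D x) y)).
  apply: cvgMr; apply: cvgB; last exact: wY.
  by rewrite (@cvg_shiftS _ (fun n => b (u x n) y)); exact: wY.
by rewrite subrr mulr0 addr0.
Unshelve. all: by end_near. Qed.

End polynomial.

(** Apply sqrt_one_minus to D = I - C, which lies between 0 and I and is
    therefore a contraction. *)
Lemma sqrt_exists C : adjoint_pair b C C ->
  (forall x, 0 <= b x (C x) <= b x x) ->
  exists S, [/\ weakly_linear b S, adjoint_pair b S S, contractive b S,
    (forall x, 0 <= b x (S x)) & forall x y, b (S (S x)) y = b (C x) y].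
Proof.
move=> Cs C01; pose D x := x - C x.
have Ds : adjoint_pair b D D by move=> x y; rewrite (siBl sb) (siBr sb) Cs.
have Dp x : 0 <= b x (D x) by rewrite (siBr sb) subr_ge0; case/andP: (C01 x).
have D1 x : b x (D x) <= 1 * b x x.
  by rewrite (siBr sb) mul1r gerBl; case/andP: (C01 x).
have Dc : contractive b D.
  move=> x; rewrite -[leRHS]mul1r -(expr1n _ 2).
  exact: (positive_operator_bound sb Ds).
have [S [Ss Sp SS]] := sqrt_one_minus Ds Dc.
have SC x y : b (S (S x)) y = b (C x) y by rewrite SS (siBl sb) opprB addrC subrK.
exists S; split=> //; first exact: adjoint_weakly_linear Ss.
by move=> x; rewrite -Ss SC (si_sym sb); case/andP: (C01 x).
Qed.

Lemma sqrt_adjoint_exists T T' : adjoint_pair b T T' -> contractive b T ->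
  exists S, [/\ weakly_linear b S, adjoint_pair b S S, contractive b S,
    (forall x, 0 <= b x (S x)) & forall x y, b (S (S x)) y = b (T (T' x)) y].
Proof.
move=> TT' Tc; have Cs : adjoint_pair b (T \o T') (T \o T').
  by move=> x y /=; rewrite TT' (adjoint_pair_sym sb TT').
apply: (sqrt_exists Cs) => x /=.
rewrite -(adjoint_pair_sym sb TT') (si_ge0 sb)/=.
exact: adjoint_contractive TT' _.
Qed.

End square_root.

Section comparison.
Context (R : realType) (V : lmodType R) (b : V -> V -> R) (e : V).
Hypotheses (sb : semi_inner b) (cb : si_complete b).

(** With u = S e - e one has S u = - u, while b u (S u) >= 0; so u is null. *)
Lemma positive_fix S : adjoint_pair b S S -> (forall x, 0 <= b x (S x)) ->
  (forall z, b (S (S e)) z = b e z) -> forall z, b (S e) z = b e z.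
Proof.
move=> Ss Sp SSe; apply/(si_eqP sb); apply/eqP; rewrite eq_le si_ge0// andbT.
have Sl := adjoint_weakly_linear sb Ss.
have := Sp (S e - e); set u := S e - e.
have -> : b u (S u) = - b u u; last by rewrite oppr_ge0.
rewrite -Ss.
have -> z : b (S u) z = b (S (S e)) z - b (S e) z.
  by rewrite /u addrC -scaleN1r Sl mulN1r addrC.
by rewrite SSe [in RHS](siBl sb) opprB.
Qed.

(** The comparison of gaps in abstract form: SA and SB are the square roots of
    A A' and B B', and B = Q A Q. Since B' = Q' A' Q' and Q' is a contraction,
    |SB f| = |B' f| <= |A' Q' f| = |SA Q' f|. The vector Q' f is orthogonal to e
    when f is, and the bound s on the form of SA turns into |SA Q' f| <= s |Q' f|
    on the orthogonal complement of e, which SA preserves because it fixes e. *)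
Lemma sqrt_compression_bound (A A' B B' Q SA SB : V -> V) (s : R) :
  adjoint_pair b A A' -> adjoint_pair b B B' ->
  weakly_linear b Q -> contractive b Q ->
  (forall x y, b (B x) y = b (Q (A (Q x))) y) ->
  (forall y, b (A e) y = b e y) -> (forall y, b (A' e) y = b e y) ->
  (forall y, b (Q e) y = b e y) ->
  adjoint_pair b SA SA -> (forall x, 0 <= b x (SA x)) ->
  (forall x y, b (SA (SA x)) y = b (A (A' x)) y) ->
  adjoint_pair b SB SB ->
  (forall x y, b (SB (SB x)) y = b (B (B' x)) y) ->
  0 <= s ->
  (forall h, b e h = 0 -> b h h = 1 -> b h (SA h) <= s) ->
  forall f, b e f = 0 -> b f (SB f) <= s * b f f.
Proof.
move=> AA' BB' Ql Qc BE Ae A'e Qe SAs SAp SAE SBs SBE s0 hs f ef.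
have SAe : forall z, b (SA e) z = b e z.
  apply: positive_fix => // z.
  by rewrite SAE AA' A'e -AA' Ae.
have hs' h : b e h = 0 -> b h (SA h) <= s * b h h.
  (* Normalize h by r = 1 / |h|. *)
  move=> eh; have [h0|hn0] := eqVneq (b h h) 0.
    by rewrite (si_null sb h0) h0 mulr0.
  have hp : 0 < b h h by rewrite lt_neqAle eq_sym hn0 (si_ge0 sb).
  pose r := (Num.sqrt (b h h))^-1.
  have rr : r * r * b h h = 1.
    by rewrite -invfM -expr2 sqr_sqrtr ?(si_ge0 sb)// mulVf.
  have := hs (r *: h); rewrite (siZr sb) eh mulr0 => /(_ erefl).
  rewrite !(siZl sb) (siZr sb) mulrA rr => /(_ erefl).
  rewrite -SAs (siZr sb) SAs mulrA => h1.
  rewrite -(ler_pM2l (x := r * r)); last first.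
    by rewrite -expr2 exprn_gt0// invr_gt0 sqrtr_gt0.
  by rewrite mulrCA rr mulr1.
have SA_e h : b e h = 0 -> b e (SA h) = 0 by rewrite -SAs SAe.
have SA_le h : b e h = 0 -> b (SA h) (SA h) <= s ^+ 2 * b h h.
  by move=> eh; apply: (positive_operator_bound sb SAs SAp); apply: hs' => //; exact: SA_e.
have [Q' QQ'] := adjoint_exists sb cb Ql Qc.
have Q'e : b e (Q' f) = 0 by rewrite -QQ' Qe.
have B'le : b (B' f) (B' f) <= b (A' (Q' f)) (A' (Q' f)).
  set X := b (B' f) (B' f).
  have XE : X = b (A' (Q' f)) (Q (B' f)).
    rewrite /X (adjoint_pair_sym sb BB') (si_sym sb) BE QQ' AA' (si_sym sb).
    by rewrite (adjoint_pair_sym sb AA') -(adjoint_pair_sym sb AA').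
  have := si_cauchy_schwarz sb (A' (Q' f)) (Q (B' f)); rewrite -XE => XX.
  have [->|Xn0] := eqVneq X 0; first by rewrite (si_ge0 sb).
  have Xp : 0 < X by rewrite lt_neqAle eq_sym Xn0 (si_ge0 sb).
  rewrite -(ler_pM2r Xp) -expr2; apply: (le_trans XX).
  by rewrite ler_wpM2l ?(si_ge0 sb)//; exact: Qc.
have Q'c := adjoint_contractive sb Qc QQ'.
have A'le : b (A' (Q' f)) (A' (Q' f)) <= s ^+ 2 * b f f.
  rewrite -AA' -SAE SAs (le_trans (SA_le _ Q'e))//.
  by rewrite ler_wpM2l ?sqr_ge0.
have SBle : b (SB f) (SB f) <= s ^+ 2 * b f f.
  by rewrite -SBs SBE BB' (le_trans B'le).
have fSB : b f (SB f) ^+ 2 <= (s * b f f) ^+ 2.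
  rewrite (le_trans (si_cauchy_schwarz sb _ _))//.
  rewrite (_ : _ ^+ 2 = b f f * (s ^+ 2 * b f f)); last by ring.
  by rewrite ler_wpM2l ?(si_ge0 sb).
rewrite (le_trans (ler_norm _))// -(@ler_pXn2r _ 2)// ?nnegrE ?mulr_ge0 ?(si_ge0 sb)//.
by rewrite -normrX ger0_norm ?sqr_ge0.
Qed.
End comparison.

(** * The Hilbert space L2 *)

Section L2_inner.
Context d (T : measurableType d) (R : realType) (pi : probability T R).
Notation L2 := (Lfun pi 2%:E).

Lemma ge1_2 : (1 <= 2%:E :> \bar R)%E.
Proof. by rewrite lee_fin ler1n. Qed.

Lemma L2_linear a f g : f \in L2 -> g \in L2 -> a *: f + g \in L2.
Proof.
by move=> fL gL; have [_] := @Lfun_submod_closed _ _ _ pi 2%:E ge1_2; apply.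
Qed.

Lemma L2_measurable f : f \in L2 -> measurable_fun setT f.
Proof. by rewrite inE => /andP[/[!inE]]. Qed.

Lemma Lnorm2_integral (f : T -> R) :
  (\int[pi]_x (`|(EFin \o f) x| `^ 2))%E = (\int[pi]_x (f x ^+ 2)%:E)%E.
Proof.
apply: eq_integral => x _ /=.
by rewrite powR_mulrn// -normrX ger0_norm ?sqr_ge0.
Qed.

Lemma L2P f : f \in L2 <->
  measurable_fun setT f /\ (\int[pi]_x (f x ^+ 2)%:E < +oo)%E.
Proof.
split=> [fL|[mf fy]].
  split; first exact: L2_measurable.
  have /integrableP[_] := Lfun2_integrable_sqr fL.
  by under eq_integral do rewrite /= ger0_norm ?sqr_ge0//.
rewrite inE; apply/andP; split; rewrite inE//= /finite_norm unlock.
by rewrite Lnorm2_integral poweR_lty.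
Qed.

Lemma L2_sqr_integral f : f \in L2 ->
  (\int[pi]_x (f x ^+ 2)%:E)%E = (inner2 pi f f)%:E.
Proof.
move=> /L2P[_ fy]; rewrite /inner2 /Rintegral -[LHS]fineK.
  by congr (fine _)%:E; apply: eq_integral => x _; rewrite expr2.
by rewrite ge0_fin_numE// integral_ge0// => x _; rewrite lee_fin sqr_ge0.
Qed.

Lemma norm2E f : f \in L2 -> norm2 pi f = (Num.sqrt (inner2 pi f f))%:E.
Proof.
move=> fL; rewrite /norm2 unlock Lnorm2_integral L2_sqr_integral//.
by rewrite poweR_EFin powR12_sqrt// -lee_fin -L2_sqr_integral// integral_ge0// => x _;
  rewrite lee_fin sqr_ge0.
Qed.

Lemma L2_mul_integrable f g : f \in L2 -> g \in L2 ->
  pi.-integrable setT (EFin \o (fun x => f x * g x)).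
Proof. by move=> fL gL; apply/Lfun1_integrable; exact: Lfun2_mul_Lfun1. Qed.

Lemma L2_integrable f : f \in L2 -> pi.-integrable setT (EFin \o f).
Proof.
move=> fL; have := L2_mul_integrable fL (Lfun_cst pi 1 2).
by apply: eq_integrable => // x _ /=; rewrite mulr1.
Qed.

Lemma inner2C f g : inner2 pi f g = inner2 pi g f.
Proof. by apply: eq_Rintegral => x _; rewrite mulrC. Qed.

Lemma inner2_linearl a f g h : f \in L2 -> g \in L2 -> h \in L2 ->
  inner2 pi (a *: f + g) h = a * inner2 pi f h + inner2 pi g h.
Proof.
move=> fL gL hL; rewrite /inner2 -RintegralZl//; last exact: L2_mul_integrable.
rewrite -RintegralD//; last 2 first.
- have := integrableZl measurableT a (L2_mul_integrable fL hL).
  by apply: eq_integrable => // x _ /=; rewrite EFinM.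
- exact: L2_mul_integrable.
by apply: eq_Rintegral => x _; rewrite !fctE mulrDl -mulrA.
Qed.

Lemma inner2_ge0 f : 0 <= inner2 pi f f.
Proof. by apply: Rintegral_ge0 => x _; rewrite -expr2 sqr_ge0. Qed.

Lemma L2B f g : f \in L2 -> g \in L2 -> f - g \in L2.
Proof.
by move=> fL gL; rewrite addrC -scaleN1r; exact: L2_linear.
Qed.

Lemma inner2_eq0 f : f \in L2 -> inner2 pi f f = 0 <-> f = 0 %[ae pi].
Proof.
move=> fL; split=> [f0|f0].
  have := @Lnorm_eq0_eq0 _ _ _ pi (EFin \o f) 2%:E.
  rewrite -/(norm2 pi f) norm2E// f0 sqrtr0.
  have mf : measurable_fun setT (EFin \o f).
    by apply/measurable_EFinP; exact: L2_measurable.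
  move=> /(_ mf (lte0n 2) erefl).
  by apply: filterS => x /= /(_ I) [] ? _.
rewrite /inner2 /Rintegral (@ae_eq_integral _ _ _ pi setT (cst 0%E))//.
- by rewrite integral_cst// mul0e.
- have mf := L2_measurable fL.
  by apply/measurable_EFinP; exact: measurable_funM.
- apply: filterS f0 => x /= /(_ I) -> _.
  by rewrite mul0r.
Qed.

Lemma ae_eq_inner2 f g : f \in L2 -> g \in L2 ->
  f = g %[ae pi] <-> inner2 pi (f - g) (f - g) = 0.
Proof.
move=> fL gL; rewrite inner2_eq0 ?L2B//; split; apply: filterS => x /= fg xT.
  by have := fg xT; rewrite !fctE => ->; rewrite subrr.
by have := fg xT; rewrite !fctE => /eqP; rewrite subr_eq0 => /eqP.
Qed.

Lemma L1_le_L2 f : f \in L2 ->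
  (\int[pi]_x `|f x|%:E <= (Num.sqrt (inner2 pi f f))%:E)%E.
Proof.
move=> fL; have mf := L2_measurable fL.
have := @hoelder _ _ _ pi f (cst 1) 2 2 mf (measurable_cst _).
rewrite -/(norm2 pi f) norm2E//.
rewrite Lnorm_cst1 [X in (X `^ _)%E](probability_setT pi) poweR1r mule1 Lnorm1.
under eq_integral do rewrite /= mulr1.
by apply => //; rewrite -[RHS](mulfV (x := 2))// mulr_natl.
Qed.

Definition L2space := LfunType pi ge1_2.
Definition L2inner (f g : L2space) : R := inner2 pi f g.

Lemma L2inner_semi_inner : semi_inner L2inner.
Proof.
split=> [a f g h|f g|f]; last exact: inner2_ge0; last exact: inner2C.
by rewrite /L2inner inner2_linearl//; exact: LfunP.
Qed.

(** On a probability space the L1 norm is at most the L2 norm, so the increments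
    are summable in L1, hence absolutely summable almost everywhere. *)
Lemma ae_cvg_of_summable (v : nat -> L2space) :
  (forall n, L2inner (v n.+1 - v n) (v n.+1 - v n) <= (2 ^- n.+1) ^+ 2) ->
  {ae pi, forall x, cvgn (fun n => v n x)}.
Proof.
move=> vv.
have mv n : measurable_fun setT (v n) by apply: L2_measurable; exact: LfunP.
pose s n x := `|v n.+1 x - v n x|%:E.
have ms n : measurable_fun setT (s n).
  by apply/measurable_EFinP/measurableT_comp => //; exact: measurable_funB.
have s0 n x : setT x -> (0 <= s n x)%E by rewrite lee_fin.
have : (\int[pi]_x (\sum_(n <oo) s n x) < +oo)%E.
  rewrite integral_nneseries//.
  apply: (@le_lt_trans _ _ (\sum_(n <oo) (1 / (2 ^ (n + 1))%:R)%:E)%E).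
    apply: lee_nneseries => [n _ _|n _]; first by apply: integral_ge0 => x; exact: s0.
    apply: (le_trans (L1_le_L2 (LfunP (v n.+1 - v n)))).
    rewrite lee_fin addn1 div1r natrX -[leRHS]ger0_norm ?invr_ge0 ?exprn_ge0//.
    by rewrite -sqrtr_sqr; apply: ler_wsqrtr; exact: vv.
  rewrite (_ : limn _ = 1%:E) ?ltry//; apply: cvg_lim => //.
  by have := @cvg_geometric_eseries_half R 1 0; rewrite expr0 divr1.
move=> fin.
have : pi.-integrable setT (fun x => \sum_(n <oo) s n x)%E.
  apply/integrableP; split.
    by apply: (@ge0_emeasurable_sum _ _ _ setT s xpredT) => // k x xT _; exact: s0.
  rewrite (eq_integral (fun x => \sum_(n <oo) s n x)%E)// => x _.
  by rewrite gee0_abs//; apply: nneseries_ge0 => n _ _; exact: s0.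
move=> /(integrable_ae measurableT); apply: filterS => x /(_ I) sx.
have : cvgn (series (fun n => v n.+1 x - v n x)).
  apply: normed_cvg; apply: nondecreasing_is_cvgn.
    by apply/nondecreasing_seqP => n; rewrite /normed_series_of seriesSr lerDl /=.
  exists (fine (\sum_(n <oo) s n x)%E) => _ [n _ <-].
  rewrite -lee_fin fineK// /normed_series_of /series/= -sumEFin.
  by apply: nneseries_lim_ge => k _; rewrite s0.
rewrite (_ : series _ = fun n => v n x - v 0%N x); last first.
  by apply/funext => n; rewrite /series/= telescope_sumr.
move=> /(is_cvgD (is_cvg_cst (v 0%N x))).
by rewrite (_ : _ + _ = fun n => v n x)//; apply/funext => n; rewrite !fctE addrC subrK.
Qed.

Lemma limn_einf_le (w : nat -> \bar R) (l : \bar R) :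
  (forall n, w n <= l)%E -> (limn_einf w <= l)%E.
Proof.
move=> wl; rewrite limn_einf_lim; apply: lime_le; first exact: is_cvg_einfs.
apply: nearW => n; apply: le_trans (wl n).
by apply: ereal_inf_lbound; exists n => /=.
Qed.

(** Riesz-Fischer: a subsequence with summable increments converges almost
    everywhere, and Fatou's lemma along it bounds the distance from u n to the
    limit by the Cauchy modulus. *)
Lemma L2inner_complete : si_complete L2inner.
Proof.
move=> u uC.
have e0 k : 0 < ((2 : R) ^- k.+1) ^+ 2 by rewrite exprn_gt0// invr_gt0 exprn_gt0.
have /choice[N HN] := fun k => uC _ (e0 k).
(* The successor makes nk k >= k, so that the subsequence is eventually beyond any
   given index. *)
pose nk k := (\sum_(i < k.+1) (N i).+1)%N.
have nkN k : (N k <= nk k)%N by rewrite /nk big_ord_recr/= -addSnnS leq_addl.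
have knk k : (k <= nk k)%N.
  elim: k => // k IH; rewrite /nk big_ord_recr/= addnS ltnS.
  exact: leq_trans IH (leq_addr _ _).
have nkS k : (nk k <= nk k.+1)%N by rewrite /nk [leqRHS]big_ord_recr/= leq_addr.
pose v k := u (nk k).
have vcvg : {ae pi, forall x, cvgn (fun n => v n x)}.
  apply: ae_cvg_of_summable => n; apply/ltW/HN => //.
  exact: leq_trans (nkN n) (nkS n).
(* The upper limit is measurable even where the subsequence diverges. *)
pose g x := fine (limn_esup (fun k => (v k x)%:E)).
have mf (f : L2space) : measurable_fun setT f by apply: L2_measurable; exact: LfunP.
have mg : measurable_fun setT g.
  apply: measurableT_comp; first exact: fine_measurable.
  by apply: measurable_fun_limn_esup => k; apply/measurable_EFinP.
have vg : {ae pi, forall x, v n x @[n --> \oo] --> g x}.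
  apply: filterS vcvg => x /cvg_ex[l vl].
  suff -> : g x = l by [].
  have /cvg_limn_einf_sup[_] : (v k x)%:E @[k --> \oo] --> l%:E.
    by apply: cvg_EFin; [exact: nearW|exact: vl].
  by rewrite /g => ->.
have fatou_bound n (e : R) K :
    (forall k, (K <= k)%N -> L2inner (u n - v k) (u n - v k) <= e) ->
    (\int[pi]_x ((u n x - g x) ^+ 2)%:E <= e%:E)%E.
  move=> uve.
  (* The shift by K makes the bound hold for every term. *)
  pose fk k x := ((u n x - v (k + K)%N x) ^+ 2)%:E.
  have mfk k : measurable_fun setT (fk k).
    by apply/measurable_EFinP/measurable_funX; exact: measurable_funB.
  apply: (@le_trans _ _ (\int[pi]_x (limn_einf (fk ^~ x)))%E).
    apply: ae_ge0_le_integral => //.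
    - by move=> x _; rewrite lee_fin sqr_ge0.
    - by apply/measurable_EFinP/measurable_funX; exact: measurable_funB.
    - move=> x _; rewrite limn_einf_lim; apply: lime_ge; first exact: is_cvg_einfs.
      apply: nearW => k; apply: le_ereal_inf_tmp => _ [l _ <-].
      by rewrite lee_fin sqr_ge0.
    - apply: measurableT_comp => //; apply: measurable_fun_limn_esup => k.
      exact: measurableT_comp.
    - apply: filterS vg => x vgx _.
      rewrite le_eqVlt; apply/orP; left; apply/eqP/esym.
      have : fk k x @[k --> \oo] --> ((u n x - g x) ^+ 2)%:E.
        apply: cvg_EFin; first by apply: nearW.
        have h : u n x - v (k + K)%N x @[k --> \oo] --> u n x - g x.
          apply: cvgB; first exact: cvg_cst.
          by rewrite (@cvg_shiftn K _ (fun k => v k x)).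
        by rewrite expr2; exact: (cvgM h h).
      by move=> /cvg_limn_einf_sup[].
  apply: (le_trans (fatou _ _ _ _)) => //; first by move=> k x _; rewrite lee_fin sqr_ge0.
  apply: limn_einf_le => k.
  by rewrite (L2_sqr_integral (LfunP (u n - v (k + K)%N))) lee_fin; apply: uve; rewrite leq_addl.
have gL : g \in L2.
  have [N1 HN1] := uC _ ltr01.
  have : (\int[pi]_x ((u N1 x - g x) ^+ 2)%:E <= 1%:E)%E.
    apply: (fatou_bound _ _ N1) => k kN; apply/ltW/HN1 => //.
    exact: leq_trans (knk k).
  move=> ugy.
  have ugL : (u N1 : T -> R) - g \in L2.
    by apply/L2P; split; [exact: measurable_funB|exact: (le_lt_trans ugy (ltry _))].
  have -> : g = (u N1 : T -> R) - ((u N1 : T -> R) - g) by rewrite opprB addrC subrK.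
  by apply: L2B => //; exact: LfunP.
pose G : L2space := Lfun_Sub ge1_2 gL.
exists G; apply/cvgrPdist_lt => e ep.
have e2 : 0 < e / 2 by rewrite divr_gt0.
have [N1 HN1] := uC _ e2.
exists N1 => // n /= nN; rewrite sub0r normrN ger0_norm ?inner2_ge0//.
apply: (@le_lt_trans _ _ (e / 2)); last by rewrite gtr_pMr// invf_lt1// ltr1n.
rewrite -lee_fin -L2_sqr_integral; last exact: (LfunP (u n - G)).
apply: (fatou_bound _ _ N1) => k kN; apply/ltW/HN1 => //.
exact: leq_trans (knk k).
Qed.

End L2_inner.

(** * The gap of a compression *)

Section L2_operators.
Context d (T : measurableType d) (R : realType) (pi : probability T R).
Notation L2 := (Lfun pi 2%:E).
Notation V := (L2space pi).
Notation ip := (@L2inner _ _ _ pi).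
Let sb := L2inner_semi_inner pi.
Let cb := @L2inner_complete _ _ _ pi.

(** The properties of averages against a kernel preserving pi that the comparison
    of gaps relies on. *)
Record markov_operator (S : (T -> R) -> (T -> R)) : Prop := MarkovOperator {
  markov_L2 : forall f, f \in L2 -> S f \in L2 ;
  markov_linear : forall a f g, f \in L2 -> g \in L2 ->
    S (a *: f + g) = a *: S f + S g %[ae pi] ;
  markov_contractive : forall f, f \in L2 ->
    inner2 pi (S f) (S f) <= inner2 pi f f ;
  markov_cst1 : S (cst 1) = cst 1 %[ae pi] ;
  markov_mean : forall f, f \in L2 -> \int[pi]_x S f x = \int[pi]_x f x }.

(** on_L2 and off_L2 pass between maps on all functions and maps on the module of
    square-integrable functions. The defaults 0 and f only concern functions that
    are not square-integrable. *)
Definition on_L2 (S : (T -> R) -> (T -> R)) (v : V) : V := insubd (0 : V) (S v).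

Definition off_L2 (W : V -> V) (f : T -> R) : T -> R :=
  if insub f is Some v then (W v : T -> R) else f.

Lemma on_L2E S (v : V) : (forall f, f \in L2 -> S f \in L2) ->
  (on_L2 S v : T -> R) = S v.
Proof. by move=> SL; apply: insubdK; apply: SL; exact: LfunP. Qed.

Lemma off_L2E W (v : V) : off_L2 W v = W v.
Proof. by rewrite /off_L2 valK. Qed.

Lemma L2spaceP f : f \in L2 -> exists v : V, (v : T -> R) = f.
Proof. by move=> fL; exists (Lfun_Sub (ge1_2 R) fL). Qed.

Lemma inner2_ae_eq f f' g : f \in L2 -> f' \in L2 -> g \in L2 ->
  f = f' %[ae pi] -> inner2 pi f g = inner2 pi f' g.
Proof.
move=> /L2spaceP[{}f <-] /L2spaceP[{}f' <-] /L2spaceP[{}g <-].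
move=> /ae_eq_inner2 h; have /(si_eqP sb) := h (LfunP _) (LfunP _).
exact.
Qed.

Lemma ae_eq_ip (f g : V) : (f : T -> R) = g %[ae pi] <-> forall z, ip f z = ip g z.
Proof.
split=> [fg z|/(si_eqP sb)]; first by apply: inner2_ae_eq => //; exact: LfunP.
by move=> h; apply/ae_eq_inner2; [exact: LfunP|exact: LfunP|exact: h].
Qed.

Lemma off_L2_bounded W : weakly_linear ip W -> contractive ip W ->
  bounded_operator pi (off_L2 W).
Proof.
move=> Wl Wc; split=> [f|f g|a f g|].
- by move=> /L2spaceP[{}f <-]; rewrite off_L2E; exact: LfunP.
- move=> /L2spaceP[{}f <-] /L2spaceP[{}g <-]; rewrite !off_L2E => /ae_eq_ip fg.
  by apply/ae_eq_ip; exact: contractive_ext.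
- move=> /L2spaceP[{}f <-] /L2spaceP[{}g <-].
  rewrite -[a *: _ + _]/((a *: f + g : V) : T -> R) !off_L2E.
  by apply/(ae_eq_ip _ (a *: W f + W g)) => z; rewrite Wl si_linearl.
- exists 1 => f /L2spaceP[{}f <-]; rewrite off_L2E mul1e !norm2E; try exact: LfunP.
  by rewrite lee_fin; apply: ler_wsqrtr; exact: Wc.
Qed.

Lemma on_L2_weakly_linear S : (forall f, f \in L2 -> S f \in L2) ->
  (forall a f g, f \in L2 -> g \in L2 -> S (a *: f + g) = a *: S f + S g %[ae pi]) ->
  weakly_linear ip (on_L2 S).
Proof.
move=> SL Sl a f g z; rewrite -(si_linearl sb).
apply: (iffLR (ae_eq_ip _ _) _ z); rewrite /= on_L2E//.
have := Sl a _ _ (LfunP f) (LfunP g).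
apply: filterS => x /= h xT; rewrite h// !fctE.
by rewrite -(on_L2E f SL) -(on_L2E g SL).
Qed.

Lemma on_L2_adjoint S S' : (forall f, f \in L2 -> S f \in L2) ->
  (forall f, f \in L2 -> S' f \in L2) ->
  (forall f g, f \in L2 -> g \in L2 -> inner2 pi (S f) g = inner2 pi f (S' g)) ->
  adjoint_pair ip (on_L2 S) (on_L2 S').
Proof.
move=> SL S'L SS' f g; rewrite /L2inner !on_L2E//.
by apply: SS'; exact: LfunP.
Qed.

Lemma on_L2_contractive S : markov_operator S -> contractive ip (on_L2 S).
Proof.
move=> mS f; rewrite /L2inner !on_L2E; [|exact: markov_L2 mS..].
by apply: (markov_contractive mS); exact: LfunP.
Qed.

Lemma markov_bounded S : markov_operator S -> bounded_operator pi S.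
Proof.
move=> mS; have SL := markov_L2 mS.
split=> //; last 2 first.
- exact: markov_linear mS.
- exists 1 => f fL; rewrite mul1e !norm2E// ?SL//.
  by rewrite lee_fin; apply: ler_wsqrtr; exact: (markov_contractive mS).
move=> f g /L2spaceP[{}f <-] /L2spaceP[{}g <-] /ae_eq_ip fg.
rewrite -(on_L2E f SL) -(on_L2E g SL); apply/ae_eq_ip.
apply: contractive_ext fg => //; last exact: on_L2_contractive.
exact: on_L2_weakly_linear SL (markov_linear mS).
Qed.

(** The adjoint is picked by choice, so this is its existence. *)
Lemma adjointP S : markov_operator S -> is_adjoint pi S (adjoint pi S).
Proof.
move=> mS; have SL := markov_L2 mS.
have Sl := on_L2_weakly_linear SL (markov_linear mS); have Sc := on_L2_contractive mS.
suff ex : exists S', is_adjoint pi S S'.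
  exact: (@xgetPex {classic ((T -> R) -> (T -> R))} id (is_adjoint pi S) ex).
have [W SW] := adjoint_exists sb cb Sl Sc.
exists (off_L2 W); split.
  apply: off_L2_bounded; first exact: (adjoint_weakly_linear sb SW).
  exact: (adjoint_contractive sb Sc SW).
move=> f g /L2spaceP[{}f <-] /L2spaceP[{}g <-].
by rewrite off_L2E -(on_L2E f SL); exact: SW.
Qed.

(** Likewise for the square root. *)
Lemma sqrt_operatorP S : markov_operator S ->
  is_sqrt_operator pi (S \o adjoint pi S) (sqrt_operator pi (S \o adjoint pi S)).
Proof.
move=> mS; have SL := markov_L2 mS.
have [[S'L _ _ _] SS'] := adjointP mS.
have Sc := on_L2_contractive mS.
set C := S \o _.
suff ex : exists W, is_sqrt_operator pi C W.
  exact: (@xgetPex {classic ((T -> R) -> (T -> R))} id (is_sqrt_operator pi C) ex).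
have [W [Wl Ws Wc Wp WW]] := sqrt_adjoint_exists sb cb (on_L2_adjoint SL S'L SS') Sc.
exists (off_L2 W); split.
- exact: off_L2_bounded.
- by move=> f g /L2spaceP[{}f <-] /L2spaceP[{}g <-]; rewrite !off_L2E; exact: Ws.
- by move=> f /L2spaceP[{}f <-]; rewrite off_L2E; exact: Wp.
- move=> f /L2spaceP[{}f <-]; rewrite !off_L2E.
  by have /ae_eq_ip := WW f; rewrite !on_L2E.
Qed.

Lemma inner2_cst1l f : inner2 pi (cst 1) f = \int[pi]_x f x.
Proof. by apply: eq_Rintegral => x _; rewrite mul1r. Qed.

(** If r is the gap of A, then <h, |A^*| h> <= 1 - r for every unit h of mean zero,
    and sqrt_compression_bound transfers this bound to B. The constant function 1
    plays the part of e: its orthogonal complement is the space of functions of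
    mean zero. *)
Theorem spectral_gap_compression A B Q :
  markov_operator A -> markov_operator B -> markov_operator Q ->
  (forall f, f \in L2 -> B f = Q (A (Q f)) %[ae pi]) ->
  (spectral_gap pi A <= spectral_gap pi B)%E.
Proof.
move=> mA mB mQ BQ.
have [[A'L _ _ _] AA'] := adjointP mA; have [[B'L _ _ _] BB'] := adjointP mB.
have [[SAL SAae SAl SAb] SAs SAp SAA] := sqrt_operatorP mA.
have [[SBL SBae SBl SBb] SBs SBp SBB] := sqrt_operatorP mB.
have AL := markov_L2 mA; have BL := markov_L2 mB; have QL := markov_L2 mQ.
have /L2spaceP[e eE] : cst 1 \in L2 := Lfun_cst pi 1 2.
have fixe S : markov_operator S -> forall z, ip (on_L2 S e) z = ip e z.
  move=> mS; apply/ae_eq_ip; rewrite on_L2E; last exact: markov_L2 mS.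
  by rewrite eE; exact: markov_cst1 mS.
have adjA := on_L2_adjoint AL A'L AA'.
have adjB := on_L2_adjoint BL B'L BB'.
have symA := on_L2_adjoint SAL SAL SAs.
have symB := on_L2_adjoint SBL SBL SBs.
have meanE (f : V) : ip e f = \int[pi]_x f x by rewrite /L2inner eE inner2_cst1l.
apply: le_ereal_inf_tmp => _ [f [[/L2spaceP[{}f <-] f0] f1] <-].
have normE (h : V) : norm2 pi h = 1%E <-> ip h h = 1.
  rewrite norm2E; last exact: LfunP.
  split=> [[h1]|h1]; last by rewrite [inner2 _ _ _]h1 sqrtr1.
  by rewrite /L2inner -[LHS]sqr_sqrtr ?inner2_ge0// h1 expr1n.
have gapE S (h : V) : (forall f, f \in L2 -> S f \in L2) -> ip h h = 1 ->
    inner2 pi h ((h : T -> R) - S h) = 1 - ip h (on_L2 S h).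
  by move=> SL h1; rewrite -(on_L2E h SL) [LHS](siBr sb) h1.
move/normE : f1 => f1; rewrite gapE//.
have gapA (h : V) : ip e h = 0 -> ip h h = 1 ->
    (spectral_gap pi A <= (1 - ip h (on_L2 (sqrt_operator pi (A \o adjoint pi A)) h))%:E)%E.
  move=> eh hh; rewrite -gapE//; apply: ereal_inf_lbound.
  exists (h : T -> R) => //; split; last exact/normE.
  by split; [exact: LfunP|rewrite -meanE].
case: (spectral_gap pi A) gapA => [r| |] gapA; last by rewrite leNye.
  rewrite lee_fin lerBrDr -lerBrDl.
  rewrite -[leRHS]mulr1 -f1.
  apply: (sqrt_compression_bound sb cb adjA adjB _ (on_L2_contractive mQ)
    _ (fixe A mA) _ (fixe Q mQ) symA _ _ symB) => //.
  - exact: on_L2_weakly_linear QL (markov_linear mQ).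
  - move=> x; apply/ae_eq_ip; rewrite !on_L2E//.
    by apply: BQ; exact: LfunP.
  - move=> y; rewrite (si_sym sb) -adjA (si_sym sb) !meanE on_L2E//.
    by apply: (markov_mean mA); exact: LfunP.
  - by move=> x; rewrite /L2inner on_L2E//; apply: SAp; exact: LfunP.
  - move=> x; apply/ae_eq_ip; rewrite !on_L2E//.
    by apply: SAA; exact: LfunP.
  - move=> x; apply/ae_eq_ip; rewrite !on_L2E//.
    by apply: SBB; exact: LfunP.
  - have := gapA f; rewrite meanE => /(_ f0 f1); rewrite lee_fin => fr.
    have := SAp f (LfunP f); rewrite -(on_L2E f SAL) -/(ip _ _); lra.
  - by move=> h eh hh; have := gapA h eh hh; rewrite lee_fin; lra.
  - by rewrite meanE.
(* The gap of A is not +oo, since f is a unit vector of mean zero. *)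
by have := gapA f; rewrite meanE => /(_ f0 f1).
Qed.

End L2_operators.

(** * Markov kernels preserving a measure *)

(** Integrals of signed functions are differences of integrals of nonnegative
    ones by definition, so no integrability is required. *)
Lemma integral_change_var d d' (Y : measurableType d) (Z : measurableType d')
    (R : realType) (m : {measure set Y -> \bar R}) (m' : {measure set Z -> \bar R})
    (h : Y -> Z) :
  (forall phi : Z -> \bar R, measurable_fun setT phi -> (forall z, 0 <= phi z)%E ->
     (\int[m']_z phi z = \int[m]_y phi (h y))%E) ->
  forall f : Z -> \bar R, measurable_fun setT f ->
    (\int[m']_z f z = \int[m]_y f (h y))%E.
Proof.
move=> H f mf; rewrite integralE [RHS]integralE; congr (_ - _)%E.
- rewrite (H _ (measurable_funepos mf) (funepos_ge0 f)).
  by apply: eq_integral => y _; rewrite !funeposE.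
- rewrite (H _ (measurable_funeneg mf) (funeneg_ge0 f)).
  by apply: eq_integral => y _; rewrite !funenegE.
Qed.

(** Jensen's inequality for the square; the right-hand side may be infinite. *)
Lemma sqr_mean_le d (T : measurableType d) (R : realType) (m : probability T R)
    (f : T -> R) : measurable_fun setT f ->
  (((\int[m]_x f x) ^+ 2)%:E <= \int[m]_x (f x ^+ 2)%:E)%E.
Proof.
move=> mf; have [fy|] := ltP (\int[m]_x (f x ^+ 2)%:E)%E +oo%E; last first.
  by rewrite leye_eq => /eqP ->; rewrite leey.
have fL : f \in Lfun m 2%:E by apply/L2P.
rewrite L2_sqr_integral// lee_fin -inner2_cst1l.
have cL : cst 1 \in Lfun m 2%:E := Lfun_cst m 1 2.
have := si_cauchy_schwarz (L2inner_semi_inner m) (Lfun_Sub (ge1_2 R) cL)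
  (Lfun_Sub (ge1_2 R) fL).
have one1 : inner2 m (cst 1) (cst 1) = 1.
  by rewrite inner2_cst1l Rintegral_cst// mul1r [X in fine X](probability_setT m).
by rewrite /L2inner /= one1 mul1r.
Qed.

Section kernel_constructions.
Local Open Scope ereal_scope.
Context d1 d2 d3 (X : measurableType d1) (Y : measurableType d2)
  (Z : measurableType d3) (R : realType).

Definition kpullback (k : R.-pker Y ~> Z) (h : X -> Y) (mh : measurable_fun setT h)
  : X -> {measure set Z -> \bar R} := fun x => k (h x).

Section kpullback.
Variables (k : R.-pker Y ~> Z) (h : X -> Y) (mh : measurable_fun setT h).

Let measurable_kpullback U : measurable U ->
  measurable_fun setT (kpullback k mh ^~ U).
Proof. by move=> mU; exact: (measurableT_comp (measurable_kernel k U mU) mh). Qed.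

HB.instance Definition _ :=
  isKernel.Build _ _ _ _ _ (kpullback k mh) measurable_kpullback.

Let kpullback_prob x : kpullback k mh x setT = 1.
Proof. exact: prob_kernel. Qed.

HB.instance Definition _ :=
  Kernel_isProbability.Build _ _ _ _ _ (kpullback k mh) kpullback_prob.
End kpullback.

Section kcomp_prob.
Variables (l : R.-pker X ~> Y) (k : R.-pker (X * Y) ~> Z).

Let kcomp_prob x : (l \; k) x setT = 1.
Proof.
have -> : (l \; k) x setT = \int[l x]_y k (x, y) setT by [].
under eq_integral do rewrite prob_kernel.
by rewrite integral_cst// prob_kernel mul1e.
Qed.

HB.instance Definition _ :=
  Kernel_isProbability.Build _ _ _ _ _ (l \; k) kcomp_prob.
End kcomp_prob.

End kernel_constructions.

Section kernel_operations.
Local Open Scope ereal_scope.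
Context d1 d2 d3 (X : measurableType d1) (Y : measurableType d2)
  (Z : measurableType d3) (R : realType).

Definition kchain (l : R.-pker X ~> Y) (k : R.-pker Y ~> Z) : R.-pker X ~> Z :=
  l \; kpullback k (@measurable_snd _ _ X Y).

Lemma integral_kchain (l : R.-pker X ~> Y) (k : R.-pker Y ~> Z) x phi :
  measurable_fun setT phi -> (forall z, 0 <= phi z) ->
  \int[kchain l k x]_z phi z = \int[l x]_y \int[k y]_z phi z.
Proof. by move=> mphi phi0; rewrite [LHS]integral_kcomp. Qed.

(** The image of the kernel k under maps that may depend on the base point. *)
Definition kimage (k : R.-pker X ~> Y) (h : X * Y -> Z) (mh : measurable_fun setT h)
  : R.-pker X ~> Z := k \; kdirac mh.

Lemma integral_kimage (k : R.-pker X ~> Y) h (mh : measurable_fun setT h) x phi :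
  measurable_fun setT phi -> (forall z, 0 <= phi z) ->
  \int[kimage k mh x]_z phi z = \int[k x]_y phi (h (x, y)).
Proof.
move=> mphi phi0; rewrite [LHS]integral_kcomp//.
by apply: eq_integral => y _; rewrite [LHS]integral_dirac// diracT mul1e.
Qed.

Definition kconst (m : probability Y R) : R.-pker X ~> Y :=
  kprobability (measurable_cst (m : pprobability Y R)).

End kernel_operations.

(** Integrating a signed function against a composition of kernels, here a measure
    m followed by a kernel K with total M. *)
Section kernel_integral.
Context d1 d2 (Y : measurableType d1) (Z : measurableType d2) (R : realType).
Variable K : R.-pker Y ~> Z.

Definition kernel_mean (f : Z -> R) (y : Y) : R := \int[K y]_z f z.

Lemma measurable_integral_kernel (phi : Z -> \bar R) :
  measurable_fun setT phi -> (forall z, 0 <= phi z)%E ->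
  measurable_fun setT (fun y => \int[K y]_z phi z)%E.
Proof.
move=> mphi phi0; apply: measurable_fun_integral_kernel => // U mU.
exact: measurable_kernel.
Qed.

Lemma measurable_kernel_mean (f : Z -> R) : measurable_fun setT f ->
  measurable_fun setT (kernel_mean f).
Proof.
move=> /measurable_EFinP mf.
rewrite /kernel_mean /Rintegral.
apply: (measurableT_comp (fine_measurable measurableT)).
under eq_fun do rewrite integralE.
apply: emeasurable_funB; apply: measurable_integral_kernel => //.
- exact: measurable_funepos.
- exact: measurable_funeneg.
Qed.

Variables (m : {measure set Y -> \bar R}) (M : {measure set Z -> \bar R}).
Hypothesis mKM : forall phi : Z -> \bar R, measurable_fun setT phi ->
  (forall z, 0 <= phi z)%E -> (\int[m]_y \int[K y]_z phi z = \int[M]_z phi z)%E.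

(** The nonnegative case applied to |f| bounds the integral over y of the integral
    of |f| against K y. *)
Lemma ae_kernel_integrable (f : Z -> R) : M.-integrable setT (EFin \o f) ->
  {ae m, forall y, (K y).-integrable setT (EFin \o f)}.
Proof.
move=> /integrableP[mf fy].
have mabs : measurable_fun setT (fun z => `|(f z)%:E|%E) by exact: measurableT_comp.
have : m.-integrable setT (fun y => \int[K y]_z `|(f z)%:E|)%E.
  apply/integrableP; split; first exact: measurable_integral_kernel.
  rewrite (eq_integral (fun y => \int[K y]_z `|(f z)%:E|)%E) => [|y _].
    by rewrite mKM.
  by rewrite gee0_abs// integral_ge0.
move=> /(integrable_ae measurableT); apply: filterS => y /(_ I) fin.
by apply/integrableP; split=> //; rewrite ltey_eq fin.
Qed.

(** kernel_mean takes the value 0 at the points where the integral is infinite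
    or undefined, so it agrees only almost everywhere with the difference of the integrals of the
    positive and negative parts, for which the statement is the nonnegative case. *)
Lemma integral_kernel_mean (f : Z -> R) : M.-integrable setT (EFin \o f) ->
  m.-integrable setT (EFin \o kernel_mean f) /\
  \int[m]_y kernel_mean f y = \int[M]_z f z.
Proof.
move=> fM; have [/measurable_EFinP mf _] := integrableP _ _ _ fM.
pose F := EFin \o f; have mF : measurable_fun setT F by apply/measurable_EFinP.
have mFp : measurable_fun setT F^\+%E by exact: measurable_funepos.
have mFn : measurable_fun setT F^\-%E by exact: measurable_funeneg.
pose p y := (\int[K y]_z F^\+ z)%E; pose n y := (\int[K y]_z F^\- z)%E.
have mp : measurable_fun setT p by exact: measurable_integral_kernel.
have mn : measurable_fun setT n by exact: measurable_integral_kernel.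
have p0 y : (0 <= p y)%E by apply: integral_ge0 => z _; exact: funepos_ge0.
have n0 y : (0 <= n y)%E by apply: integral_ge0 => z _; exact: funeneg_ge0.
have ip : m.-integrable setT p.
  apply/integrableP; split=> //.
  rewrite (eq_integral p) => [|y _]; last by rewrite gee0_abs.
  by rewrite /p mKM// ltey_eq (integrable_pos_fin_num _ fM).
have inn : m.-integrable setT n.
  apply/integrableP; split=> //.
  rewrite (eq_integral n) => [|y _]; last by rewrite gee0_abs.
  by rewrite /n mKM// ltey_eq (integrable_neg_fin_num _ fM).
have kmE y : kernel_mean f y = fine (p y - n y)%E.
  by rewrite /kernel_mean /Rintegral integralE.
have mkm := measurable_kernel_mean mf.
split.
  apply: le_integrable (integrableD measurableT ip inn) => //.
    exact/measurable_EFinP.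
  move=> y _; rewrite [X in (`|X| <= _)%E]/= kmE [leRHS]gee0_abs; last first.
    by apply: adde_ge0; [exact: p0|exact: n0].
  rewrite [leRHS]/(p y + n y)%E.
  move: (p y) (n y) (p0 y) (n0 y) => [a| |] [b| |] //= a0 b0; rewrite ?normr0 ?leey//.
  by rewrite lee_fin (le_trans (ler_normB _ _))// !ger0_norm.
rewrite {1}/Rintegral; congr fine.
rewrite (@ae_eq_integral _ _ _ m setT (p \- n)%E)//.
- rewrite integralB// /p /n mKM// mKM//.
  by rewrite -integralE.
- exact/measurable_EFinP.
- exact: emeasurable_funB.
have := integrable_ae measurableT ip; have := integrable_ae measurableT inn.
apply: filterS2 => y /(_ I) ny /(_ I) py _ /=.
by rewrite kmE fineK// fin_numB py ny.
Qed.

End kernel_integral.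

(** Kernels are compared through their integrals of nonnegative functions, which
    exist everywhere; integrability of f is then required only against M x. *)
Lemma kernel_mean_comp d1 d2 d3 (X : measurableType d1) (Y : measurableType d2)
    (Z : measurableType d3) (R : realType) (k : R.-pker X ~> Y) (l : R.-pker Y ~> Z)
    (M : R.-pker X ~> Z) (x : X) (f : Z -> R) :
  (forall phi : Z -> \bar R, measurable_fun setT phi -> (forall z, 0 <= phi z)%E ->
     (\int[k x]_y \int[l y]_z phi z = \int[M x]_z phi z)%E) ->
  (M x).-integrable setT (EFin \o f) ->
  kernel_mean M f x = kernel_mean k (kernel_mean l f) x.
Proof. by move=> klM /(integral_kernel_mean klM)[_ e]; exact: esym e. Qed.

Section kernel_probability.
Context d1 d2 (Y : measurableType d1) (Z : measurableType d2) (R : realType).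

(** A copy of K y that carries its structure of probability measure. *)
Definition kernel_probability (K : R.-pker Y ~> Z) (y : Y) := (K y : set Z -> \bar R).

HB.instance Definition _ K y := Measure.on (kernel_probability K y).

HB.instance Definition _ K y :=
  Measure_isProbability.Build _ _ _ (kernel_probability K y) (prob_kernel (s := K) y).

End kernel_probability.

Section stationary_kernels.
Context d (T : measurableType d) (R : realType) (pi : probability T R).
Notation L2 := (Lfun pi 2%:E).

(** Stationarity in the form that composes: integrals of nonnegative functions
    instead of measures of sets. *)
Definition preserves (K : R.-pker T ~> T) :=
  forall phi : T -> \bar R, measurable_fun setT phi -> (forall z, 0 <= phi z)%E ->
  (\int[pi]_x \int[K x]_y phi y = \int[pi]_x phi x)%E.

Lemma preserves_ae_integrable K f : preserves K -> f \in L2 ->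
  {ae pi, forall x, (K x).-integrable setT (EFin \o f)}.
Proof. by move=> Kpi fL; exact: (ae_kernel_integrable Kpi (L2_integrable fL)). Qed.

(** Both sides integrate phi against measures that agree on measurable sets, the
    left one being the composition of the constant kernel pi with K. *)
Lemma stationary_preserves K : stationary pi K -> preserves K.
Proof.
move=> sK phi mphi phi0.
rewrite -(integral_kchain (kconst T pi) K point mphi phi0).
apply: eq_measure_integral => A mA _.
by rewrite -(sK A mA).
Qed.

(** Contractivity is Jensen's inequality at each point followed by stationarity;
    linearity holds at the points x where both functions are integrable against
    K x, hence almost everywhere. *)
Lemma preserves_markov K : preserves K -> markov_operator pi (kernel_mean K).
Proof.
move=> Kpi.
have msq (f : T -> R) : measurable_fun setT f -> measurable_fun setT (fun x => (f x ^+ 2)%:E).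
  by move=> mf; apply/measurable_EFinP; exact: measurable_funX.
have contr (f : T -> R) : measurable_fun setT f ->
    (\int[pi]_x (kernel_mean K f x ^+ 2)%:E <= \int[pi]_x (f x ^+ 2)%:E)%E.
  move=> mf; rewrite -(Kpi (fun x => (f x ^+ 2)%:E)); last 2 first.
  - exact: msq.
  - by move=> z; rewrite lee_fin sqr_ge0.
  apply: ge0_le_integral => //.
  - by move=> x _; rewrite lee_fin sqr_ge0.
  - exact/msq/measurable_kernel_mean.
  - apply: measurable_integral_kernel; first exact: msq.
    by move=> z; rewrite lee_fin sqr_ge0.
  - by move=> x _; exact: (sqr_mean_le (kernel_probability K x) mf).
have KL (f : T -> R) : f \in L2 -> kernel_mean K f \in L2.
  move=> /L2P[mf fy]; apply/L2P; split; first exact: measurable_kernel_mean.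
  exact: le_lt_trans (contr _ mf) fy.
split=> //.
- move=> a f g fL gL.
  apply: filterS2 (preserves_ae_integrable Kpi fL) (preserves_ae_integrable Kpi gL).
  move=> x fx gx _; rewrite !fctE /kernel_mean.
  rewrite -[RHS]/(a * \int[K x]_y f y + \int[K x]_y g y).
  rewrite -RintegralZl// -RintegralD//.
  have := integrableZl measurableT a fx.
  by apply: eq_integrable => // y _ /=; rewrite EFinM.
- move=> f fL; rewrite -lee_fin -(L2_sqr_integral fL) -(L2_sqr_integral (KL _ fL)).
  exact/contr/(L2_measurable fL).
- apply: nearW => x _; rewrite /kernel_mean Rintegral_cst// mul1r.
  by rewrite [X in fine X]prob_kernel.
- by move=> f /L2_integrable fi; have [_ ->] := integral_kernel_mean Kpi fi.
Qed.

Lemma kernel_mean_comp_ae (K L M : R.-pker T ~> T) f : preserves M ->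
  (forall x (phi : T -> \bar R), measurable_fun setT phi -> (forall z, 0 <= phi z)%E ->
     (\int[K x]_y \int[L y]_z phi z = \int[M x]_z phi z)%E) ->
  f \in L2 -> kernel_mean M f = kernel_mean K (kernel_mean L f) %[ae pi].
Proof.
move=> Mpi KLM fL; apply: filterS (preserves_ae_integrable Mpi fL) => x fx _.
exact: kernel_mean_comp (KLM x) fx.
Qed.

End stationary_kernels.

Section markov_ae.
Context d (T : measurableType d) (R : realType) (pi : probability T R).
Notation L2 := (Lfun pi 2%:E).

Lemma ae_eqfun_trans (f g h : T -> R) :
  f = g %[ae pi] -> g = h %[ae pi] -> f = h %[ae pi].
Proof. by apply: filterS2 => x fg gh xT; rewrite fg// gh. Qed.

Lemma ae_eqfun_sym (f g : T -> R) : f = g %[ae pi] -> g = f %[ae pi].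
Proof. by apply: filterS => x fg xT; rewrite fg. Qed.

(** P_da agrees with the average against a kernel only almost everywhere. *)
Lemma markov_operator_ae (S S' : (T -> R) -> (T -> R)) :
  markov_operator pi S ->
  (forall f, f \in L2 -> measurable_fun setT (S' f)) ->
  (forall f, f \in L2 -> S' f = S f %[ae pi]) ->
  markov_operator pi S'.
Proof.
move=> mS mS' SS'.
have sqrE f : f \in L2 ->
    (\int[pi]_x (S' f x ^+ 2)%:E = \int[pi]_x (S f x ^+ 2)%:E)%E.
  move=> fL; apply: ae_eq_integral => //.
  - by apply/measurable_EFinP/measurable_funX; exact: mS'.
  - by apply/measurable_EFinP/measurable_funX/(L2_measurable (pi := pi))/(markov_L2 mS).
  - by apply: filterS (SS' f fL) => x h xT; rewrite h.
have S'L f : f \in L2 -> S' f \in L2.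
  move=> fL; apply/L2P; split; first exact: mS'.
  by rewrite sqrE//; have /L2P[] := markov_L2 mS fL.
split=> //.
- move=> a f g fL gL.
  have fgL := L2_linear a fL gL.
  have h3 : a *: S f + S g = a *: S' f + S' g %[ae pi].
    by apply: filterS2 (SS' _ fL) (SS' _ gL) => x hf hg xT; rewrite !fctE hf// hg.
  apply: filterS3 (SS' _ fgL) (markov_linear mS a fL gL) h3 => x h1 h2 h3 xT.
  by rewrite h1// h2// h3.
- move=> f fL; rewrite -lee_fin -(L2_sqr_integral (S'L _ fL)) sqrE//.
  by rewrite (L2_sqr_integral (markov_L2 mS fL)) lee_fin; exact: (markov_contractive mS).
- have cL : cst 1 \in L2 := Lfun_cst pi 1 2.
  by apply: filterS2 (SS' _ cL) (markov_cst1 mS) => x h1 h2 xT; rewrite h1// h2.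
- move=> f fL; rewrite -(markov_mean mS fL) /Rintegral; congr fine.
  apply: ae_eq_integral => //.
  - by apply/measurable_EFinP; exact: mS'.
  - by apply/measurable_EFinP/(L2_measurable (pi := pi))/(markov_L2 mS).
  - by apply: filterS (SS' f fL) => x h xT; rewrite h.
Qed.
End markov_ae.

(** * Averages along the group action *)

Section action.
Context (R : realType) (G : topologicalGroupType) (X : ptopologicalType).
Variable act : G -> X -> X.
Hypothesis hact : measurable_action act.
Notation BG := (borelType G).
Notation BX := (borelType X).
Local Open Scope ereal_scope.

Lemma continuous_borel_measurable (f : G -> G) : continuous f ->
  measurable_fun [set: BG] (f : BG -> BG).
Proof.
move=> /continuousP cf; apply: (@measurability _ _ BG BG setT f (@open G)) => //.
move=> _ [U oU <-]; rewrite setTI; apply: sub_sigma_algebra; exact: cf.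
Qed.

Lemma measurable_mulgl (g : G) : measurable_fun [set: BG] ((fun h => g * h)%g : BG -> BG).
Proof.
apply: continuous_borel_measurable => x.
apply: (continuous_comp (f := fun h : G => (g, h)) (g := fun xy : G * G => (xy.1 * xy.2)%g)).
  by apply: cvg_pair; [exact: cvg_cst|exact: cvg_id].
exact: mulg_continuous.
Qed.

Lemma measurable_invg : measurable_fun [set: BG] ((fun h => h^-1)%g : BG -> BG).
Proof. apply: continuous_borel_measurable; exact: invg_continuous. Qed.

Lemma measurable_act d (T : measurableType d) (a : T -> BG) (b : T -> BX) :
  measurable_fun setT a -> measurable_fun setT b ->
  measurable_fun setT (fun t => act (a t) (b t) : BX).
Proof.
move=> ma mb; have [_ _ m] := hact.
exact: (measurableT_comp m (measurable_fun_pair ma mb)).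
Qed.

Lemma act1 x : act 1%g x = x. Proof. by case: hact. Qed.
Lemma actM g h x : act (g * h)%g x = act g (act h x). Proof. by case: hact. Qed.
Lemma actK g x : act g^-1%g (act g x) = x.
Proof. by rewrite -actM mulVg act1. Qed.
Lemma actKV g x : act g (act g^-1%g x) = x.
Proof. by rewrite -actM mulgV act1. Qed.

Lemma integral_act (m : {measure set BX -> \bar R}) (g : G) (phi : BX -> \bar R) :
  invariant_under act m -> measurable_fun setT phi -> (forall x, 0 <= phi x) ->
  \int[m]_x phi (act g x) = \int[m]_x phi x.
Proof.
move=> minv mphi phi0.
have mg : measurable_fun setT (act g : BX -> BX).
  by apply: measurable_act; [exact: measurable_cst|exact: measurable_id].
have := @ge0_integral_pushforward _ _ BX BX R (act g) mg m setT phi measurableT mphi.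
rewrite preimage_setT => <- //.
apply: eq_measure_integral => A mA _.
rewrite /pushforward -(minv g^-1%g A mA); congr (m _).
apply/seteqP; split=> [x /= Ax|_ [x Ax <-] /=]; last by rewrite actKV.
by exists (act g x) => //; rewrite actK.
Qed.

Lemma integral_haar_translate (mu : {measure set BG -> \bar R}) (g : G) (phi : BG -> \bar R) :
  haar_measure mu -> measurable_fun setT phi -> (forall x, 0 <= phi x) ->
  \int[mu]_h phi (g * h)%g = \int[mu]_h phi h.
Proof.
move=> [_ minv _ _ _] mphi phi0.
have mg := measurable_mulgl g.
have := @ge0_integral_pushforward _ _ BG BG R (fun h => g * h)%g mg mu setT phi measurableT mphi.
rewrite preimage_setT => <- //.
apply: eq_measure_integral => A mA _.
rewrite /pushforward -(minv g^-1%g A mA); congr (mu _).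
apply/seteqP; split=> [h /= Ah|_ [h Ah <-] /=]; last by rewrite mulgA mulgV mul1g.
by exists (g * h)%g => //; rewrite mulgA mulVg mul1g.
Qed.

Section averaging.
Variable (mu : probability BG R).
Hypothesis hmu : haar_measure mu.

Definition orbit_mean (phi : BX -> \bar R) (x : BX) := \int[mu]_g phi (act g x).

(** Let F be the average of phi over the inverse orbit g |-> act g^-1 y. The change
    of variable g |-> h g shows that F is constant on orbits. Averaging the
    function (g, h) |-> phi (act g^-1 (act h y)) first over h gives the orbit mean
    of phi, by left invariance, and first over g gives F; so the two coincide. The
    exchange is licit because (g, h) |-> act g^-1 (act h y) is measurable for the
    product sigma-algebra, although (g, h) |-> g^-1 h need not be. *)
Lemma orbit_mean_invariant (phi : BX -> \bar R) (k : G) (x : X) :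
  measurable_fun setT phi -> (forall x, 0 <= phi x) ->
  orbit_mean phi (act k x) = orbit_mean phi x.
Proof.
move=> mphi phi0.
pose F y := \int[mu]_g phi (act g^-1%g y).
have morb d (T : measurableType d) (a : T -> BG) y : measurable_fun setT a ->
    measurable_fun setT (fun t => phi (act (a t) y)).
  move=> ma.
  exact: (measurableT_comp mphi (measurable_act ma (measurable_cst (y : BX)))).
have Finv h y : F (act h y) = F y.
  rewrite /F -(integral_haar_translate h hmu (phi := fun g => phi (act g^-1%g (act h y))))//.
    by apply: eq_integral => g _; rewrite invgM actM actK.
  exact: (morb _ _ _ (act h y) measurable_invg).
suff meanF y : orbit_mean phi y = F y by rewrite !meanF Finv.
have translate g : \int[mu]_h phi (act g^-1%g (act h y)) = orbit_mean phi y.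
  rewrite /orbit_mean -(integral_haar_translate g^-1%g hmu (phi := fun h => phi (act h y)))//.
    by apply: eq_integral => h _; rewrite actM.
  exact: (morb _ BG id y (@measurable_id _ BG setT)).
transitivity (\int[mu]_g \int[mu]_h phi (act g^-1%g (act h y))).
  rewrite (eq_integral (cst (orbit_mean phi y))); last by move=> g _; rewrite translate.
  by rewrite integral_cst// [X in _ = _ * X](probability_setT mu) mule1.
rewrite (@fubini_tonelli _ _ _ _ _ mu mu (fun gh => phi (act gh.1^-1%g (act gh.2 y))))//=.
- rewrite (eq_integral (cst (F y))) => [|h _]; last exact: Finv.
  by rewrite integral_cst// [X in _ * X = _](probability_setT mu) mule1.
- apply: (measurableT_comp mphi).
  apply: measurable_act; first exact: (measurableT_comp measurable_invg).
  exact: (measurable_act measurable_snd (measurable_cst (y : BX))).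
Qed.

End averaging.

Section kernels.
Variable P : R.-pker BX ~> BX.

Lemma measurable_shift_base :
  measurable_fun setT (fun xgh : BX * (BG * BG) => act xgh.2.1 xgh.1 : BX).
Proof. by apply: measurable_act => //; exact: measurableT_comp. Qed.

Lemma measurable_shift_image :
  measurable_fun setT (fun z : BX * (BG * BG) * BX => act z.1.2.2 z.2 : BX).
Proof.
apply: measurable_act => //.
by do 2 apply: measurableT_comp => //.
Qed.

Lemma measurable_orbit_kernel :
  measurable_fun setT (fun z : BX * BG => act z.2 z.1 : BX).
Proof. exact: measurable_act. Qed.

(** At (x, (g, h)): the law of act h Y for Y drawn from P (act g x). *)
Definition shifted_kernel : R.-pker (BX * (BG * BG))%type ~> BX :=
  kimage (kpullback P measurable_shift_base) measurable_shift_image.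

(** The product of the point mass at x with nu. It turns the average over nu in
    P_da into an integral against a kernel, see P_daE, whence its measurability
    in x. *)
Definition with_law (nu : probability (BG * BG)%type R) :
    R.-pker BX ~> (BX * (BG * BG))%type :=
  kimage (kconst BX nu) (@measurable_id _ (BX * (BG * BG))%type setT).

Definition da_kernel nu : R.-pker BX ~> BX := kchain (with_law nu) shifted_kernel.

Definition orbit_kernel (mu : probability BG R) : R.-pker BX ~> BX :=
  kimage (kconst BX mu) measurable_orbit_kernel.

Lemma integral_shifted_kernel x (phi : BX -> \bar R) :
  measurable_fun setT phi -> (forall x, 0 <= phi x) ->
  \int[shifted_kernel x]_y phi y = \int[P (act x.2.1 x.1)]_y phi (act x.2.2 y).
Proof. by move=> mphi phi0; rewrite integral_kimage. Qed.

Lemma integral_da_kernel nu x (phi : BX -> \bar R) :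
  measurable_fun setT phi -> (forall x, 0 <= phi x) ->
  \int[da_kernel nu x]_y phi y =
  \int[nu]_gh \int[P (act gh.1 x)]_y phi (act gh.2 y).
Proof.
move=> mphi phi0; rewrite integral_kchain//.
rewrite integral_kimage; last 2 first.
- exact: measurable_integral_kernel.
- by move=> z; exact: integral_ge0.
by apply: eq_integral => gh _; rewrite integral_shifted_kernel.
Qed.

Lemma integral_orbit_kernel mu x (phi : BX -> \bar R) :
  measurable_fun setT phi -> (forall x, 0 <= phi x) ->
  \int[orbit_kernel mu x]_y phi y = orbit_mean mu phi x.
Proof. by move=> mphi phi0; rewrite integral_kimage. Qed.

Section stationarity.
Variable pi : probability BX R.
Hypothesis hpi : invariant_under act pi.

Lemma orbit_kernel_preserves mu : preserves pi (orbit_kernel mu).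
Proof.
move=> phi mphi phi0.
under eq_integral do rewrite integral_orbit_kernel//.
rewrite (@fubini_tonelli _ _ _ _ _ pi mu (fun z => phi (act z.2 z.1)))//=; last first.
  exact: (measurableT_comp mphi measurable_orbit_kernel).
rewrite (eq_integral (cst (\int[pi]_x phi x))) => [|g _]; last exact: integral_act.
by rewrite integral_cst// [X in _ * X](probability_setT mu) mule1.
Qed.

Hypothesis hP : stationary pi P.

(** For fixed (g, h) the integral over pi is preserved by the shift by h, then by P,
    then by the shift by g. *)
Lemma da_kernel_preserves nu : preserves pi (da_kernel nu).
Proof.
move=> phi mphi phi0.
under eq_integral do rewrite integral_da_kernel//.
have m1 := measurable_integral_kernel shifted_kernel mphi phi0.
rewrite (@fubini_tonelli _ _ _ _ _ pi nu
  (fun z => \int[P (act z.2.1 z.1)]_y phi (act z.2.2 y)))//=; last 2 first.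
- by move: m1; under eq_fun do rewrite integral_shifted_kernel//.
- by move=> z; exact: integral_ge0.
rewrite (eq_integral (cst (\int[pi]_x phi x))) => [|gh _].
  by rewrite integral_cst// [X in _ * X](probability_setT nu) mule1.
have mphih : measurable_fun setT (fun y : BX => phi (act gh.2 y)).
  exact: (measurableT_comp mphi (measurable_act (measurable_cst (gh.2 : BG)) (@measurable_id _ BX setT))).
rewrite (integral_act _ (phi := fun x => \int[P x]_y phi (act gh.2 y)))//; last 2 first.
- exact: measurable_integral_kernel.
- by move=> z; exact: integral_ge0.
rewrite (stationary_preserves hP)//.
exact: integral_act.
Qed.

Lemma P_daE (nu : probability (BG * BG)%type R) (f : BX -> R) x :
  measurable_fun setT f ->
  P_da act P nu f x = kernel_mean (with_law nu) (kernel_mean shifted_kernel f) x.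
Proof.
move=> mf; have mF : measurable_fun setT (EFin \o f) by apply/measurable_EFinP.
have innerE gh : kernel_mean shifted_kernel f (x, gh) =
    U_ act gh.1 (kernel_operator P (U_ act gh.2 f)) x.
  rewrite /kernel_mean /Rintegral; congr fine.
  apply: (@integral_change_var _ _ _ _ _ _ _ (act gh.2 : BX -> BX)) => // phi mphi phi0.
  by rewrite integral_shifted_kernel.
rewrite /P_da; under eq_Rintegral do rewrite -innerE.
rewrite /kernel_mean /Rintegral; congr fine; apply/esym.
apply: (@integral_change_var _ _ _ _ _ nu _ (fun gh => (x, gh) : BX * (BG * BG))).
- by move=> phi mphi phi0; rewrite integral_kimage.
- by apply/measurable_EFinP; exact: measurable_kernel_mean.
Qed.

Lemma P_da_measurable (nu : probability (BG * BG)%type R) (f : BX -> R) :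
  measurable_fun setT f ->
  measurable_fun [set: BX] (P_da act P nu f).
Proof.
move=> mf; rewrite (_ : P_da act P nu f =
  kernel_mean (with_law nu) (kernel_mean shifted_kernel f)).
  by do 2 apply: measurable_kernel_mean.
by apply/funext => x; exact: P_daE.
Qed.

(** P_da integrates in two stages, each with the convention that an infinite or
    undefined integral is 0; it agrees with a single integral against da_kernel wherever f is
    integrable against the latter. *)
Lemma P_da_ae (nu : probability (BG * BG)%type R) f : f \in Lfun pi 2%:E ->
  P_da act P nu f = kernel_mean (da_kernel nu) f %[ae pi].
Proof.
move=> fL; have mf := L2_measurable fL.
apply: filterS (preserves_ae_integrable (da_kernel_preserves nu) fL) => x fx _.
rewrite P_daE//; apply/esym; apply: kernel_mean_comp fx => phi mphi phi0.
exact: esym (integral_kchain (with_law nu) shifted_kernel x mphi phi0).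
Qed.

Lemma P_da_markov (nu : probability (BG * BG)%type R) : markov_operator pi (P_da act P nu).
Proof.
apply: markov_operator_ae (preserves_markov (da_kernel_preserves nu)) _ _.
- by move=> f /L2_measurable; exact: P_da_measurable.
- by move=> f; exact: P_da_ae.
Qed.

End stationarity.

Section compression.
Variable mu : probability BG R.
Hypothesis hmu : haar_measure mu.

(** A copy of the product measure that carries its structure of probability. *)
Definition haar_square := (mu \x mu : set (BG * BG) -> \bar R).

HB.instance Definition _ := Measure.on haar_square.

Let haar_square_setT : haar_square setT = 1.
Proof.
rewrite /haar_square -setXTT product_measure1E//.
by rewrite [X in X * _](probability_setT mu) mul1e [LHS](probability_setT mu).
Qed.

HB.instance Definition _ :=
  Measure_isProbability.Build _ _ _ haar_square haar_square_setT.

Lemma measurable_orbit_mean phi : measurable_fun setT phi -> (forall x, 0 <= phi x) ->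
  measurable_fun [set: BX] (orbit_mean mu phi).
Proof.
move=> mphi phi0.
rewrite (_ : orbit_mean mu phi = fun x => \int[orbit_kernel mu x]_y phi y).
  exact: measurable_integral_kernel.
by apply/funext => x; rewrite integral_orbit_kernel.
Qed.

Lemma orbit_mean_ge0 phi : (forall x, 0 <= phi x) -> forall x, 0 <= orbit_mean mu phi x.
Proof. by move=> phi0 x; exact: integral_ge0. Qed.

(** The operator Q P Q on nonnegative functions. *)
Definition compressed_mean (phi : BX -> \bar R) (x : BX) :=
  orbit_mean mu (fun z => \int[P z]_y orbit_mean mu phi y) x.

(** Q A Q = Q P Q. The inner Q absorbs the translation by h, by
    orbit_mean_invariant, and the outer one absorbs the translation by g, by left
    invariance of mu; what remains does not depend on (g, h), and nu has mass 1. *)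
Lemma compression_da_kernel nu x (phi : BX -> \bar R) :
  measurable_fun setT phi -> (forall x, 0 <= phi x) ->
  \int[orbit_kernel mu x]_y \int[kchain (da_kernel nu) (orbit_kernel mu) y]_z phi z =
  compressed_mean phi x.
Proof.
move=> mphi phi0.
pose w z := \int[P z]_y orbit_mean mu phi y.
have mw : measurable_fun setT w.
  by apply: measurable_integral_kernel; [exact: measurable_orbit_mean|exact: orbit_mean_ge0].
have w0 z : 0 <= w z by apply: integral_ge0 => y _; exact: orbit_mean_ge0.
have inner y : \int[kchain (da_kernel nu) (orbit_kernel mu) y]_z phi z =
    \int[nu]_gh w (act gh.1 y).
  rewrite (integral_kchain (da_kernel nu) (orbit_kernel mu) y mphi phi0).
  rewrite (eq_integral (orbit_mean mu phi)); last first.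
    by move=> z _; rewrite (integral_orbit_kernel mu z mphi phi0).
  rewrite (integral_da_kernel nu y (measurable_orbit_mean mphi phi0) (orbit_mean_ge0 phi0)).
  apply: eq_integral => gh _; apply: eq_integral => z _.
  exact: orbit_mean_invariant.
rewrite (integral_orbit_kernel mu x
  (measurable_integral_kernel (kchain (da_kernel nu) (orbit_kernel mu)) mphi phi0));
  last by move=> z; exact: integral_ge0.
transitivity (\int[mu]_g \int[nu]_gh w (act gh.1 (act g x))).
  by apply: eq_integral => g _; exact: inner.
rewrite (@fubini_tonelli _ _ _ _ _ mu nu (fun z => w (act z.2.1 (act z.1 x))))//=.
- rewrite (eq_integral (cst (orbit_mean mu w x))) => [|gh _].
    by rewrite integral_cst// [X in _ * X](probability_setT nu) mule1.
  rewrite /cst /orbit_mean.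
  rewrite -(integral_haar_translate gh.1 hmu (phi := fun g => w (act g x)))//.
    by apply: eq_integral => g _; rewrite actM.
  exact: (measurableT_comp mw (measurable_act (@measurable_id _ BG setT)
    (measurable_cst (x : BX)))).
- apply: (measurableT_comp mw); apply: measurable_act.
    exact: (measurableT_comp measurable_fst).
  exact: (measurable_act measurable_fst (measurable_cst (x : BX))).
Qed.

(** B = Q P Q: integrate over h before applying P. *)
Lemma haar_square_da_kernel x (phi : BX -> \bar R) :
  measurable_fun setT phi -> (forall x, 0 <= phi x) ->
  \int[da_kernel haar_square x]_y phi y = compressed_mean phi x.
Proof.
move=> mphi phi0; rewrite (integral_da_kernel _ _ mphi phi0).
have m1 := measurable_integral_kernel shifted_kernel mphi phi0.
pose v (gh : BG * BG) := \int[P (act gh.1 x)]_y phi (act gh.2 y).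
have mv : measurable_fun setT v.
  rewrite (_ : v = fun gh => \int[shifted_kernel (x, gh)]_y phi y).
    exact: (measurable_fun_pair2 (f := fun z => \int[shifted_kernel z]_y phi y)).
  by apply/funext => gh; rewrite integral_shifted_kernel.
have v0 gh : 0 <= v gh by exact: integral_ge0.
rewrite [LHS](@fubini_tonelli1 _ _ _ _ _ mu mu v)//.
rewrite /compressed_mean {1}/orbit_mean; apply: eq_integral => g _.
rewrite /fubini_F /v /=.
rewrite (@fubini_tonelli _ _ _ _ _ mu (kernel_probability P (act g x))
  (fun z => phi (act z.1 z.2)))//.
exact: (measurableT_comp mphi (measurable_act measurable_fst measurable_snd)).
Qed.

End compression.

End kernels.

End action.

Theorem corollary3p1 (R : realType)
  (X : ptopologicalType) (hX : polish_space R X)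
  (pi : probability (borelType X) R)
  (P : R.-pker (borelType X) ~> (borelType X))
  (hP : stationary pi P)
  (hPc : compact_operator pi (kernel_operator P))
  (G : topologicalGroupType) (hG : locally_compact [set: G])
  (mu : probability (borelType G) R) (hmu : haar_measure mu)
  (act : G -> X -> X) (hact : measurable_action act)
  (m : {measure set (borelType X) -> \bar R})
  (hm : invariant_under act m) (hpim : has_density pi m)
  (hpi : invariant_under act pi)
  (nu : probability (borelType G * borelType G)%type R) :
  (spectral_gap pi (P_la_ra act P mu) >= spectral_gap pi (P_da act P nu))%E.
Proof.
have mA := P_da_markov hact hpi hP nu.
have mB := P_da_markov hact hpi hP (haar_square mu).
have Qpi := orbit_kernel_preserves hact hpi mu.
have mQ := preserves_markov Qpi.
have Api := da_kernel_preserves hact hpi hP nu.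
have AQpi : preserves pi (kchain (da_kernel hact P nu) (orbit_kernel hact mu)).
  move=> phi mphi phi0.
  have mQphi := measurable_integral_kernel (orbit_kernel hact mu) mphi phi0.
  have Qphi0 x : (0 <= \int[orbit_kernel hact mu x]_y phi y)%E by exact: integral_ge0.
  rewrite -(Qpi phi mphi phi0) -(Api _ mQphi Qphi0).
  by apply: eq_integral => x _; exact: (integral_kchain _ _ x mphi phi0).
apply: (spectral_gap_compression mA mB mQ) => f fL.
have QL := markov_L2 mQ fL.
have [_ Qae _ _] := markov_bounded mQ.
have step1 := P_da_ae hact hpi hP (haar_square mu) fL.
have step2 : kernel_mean (da_kernel hact P (haar_square mu)) f =
    kernel_mean (orbit_kernel hact mu)
      (kernel_mean (kchain (da_kernel hact P nu) (orbit_kernel hact mu)) f) %[ae pi].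
  apply: kernel_mean_comp_ae fL; first exact: da_kernel_preserves.
  move=> x phi mphi phi0; rewrite (haar_square_da_kernel _ _ _ x mphi phi0).
  exact: compression_da_kernel.
have step3 : kernel_mean (kchain (da_kernel hact P nu) (orbit_kernel hact mu)) f =
    kernel_mean (da_kernel hact P nu) (kernel_mean (orbit_kernel hact mu) f) %[ae pi].
  apply: kernel_mean_comp_ae fL => // x phi mphi phi0.
  exact: esym (integral_kchain _ _ x mphi phi0).
have step4 := P_da_ae hact hpi hP nu QL.
have step5 : kernel_mean (orbit_kernel hact mu)
      (kernel_mean (kchain (da_kernel hact P nu) (orbit_kernel hact mu)) f) =
    kernel_mean (orbit_kernel hact mu)
      (P_da act P nu (kernel_mean (orbit_kernel hact mu) f)) %[ae pi].
  apply: Qae; first exact: (markov_L2 (preserves_markov AQpi)).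
    exact: (markov_L2 mA).
  exact: ae_eqfun_trans step3 (ae_eqfun_sym step4).
exact: ae_eqfun_trans step1 (ae_eqfun_trans step2 step5).
Qed.
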